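(* Let $\eta_{ij}$ be a nondegenerate symmetric constant $N\times N$ matrix with inverse $\eta^{ij}$, and let $\Phi(u)$, $u=(u^1,\dots,u^N)$, be any solution of the equations of associativity $$\sum_{m=1}^N\sum_{n=1}^N\eta^{mn}\frac{\partial^3\Phi}{\partial u^i\partial u^j\partial u^m}\frac{\partial^3\Phi}{\partial u^n\partial u^k\partial u^l}=\sum_{m=1}^N\sum_{n=1}^N\eta^{mn}\frac{\partial^3\Phi}{\partial u^i\partial u^k\partial u^m}\frac{\partial^3\Phi}{\partial u^n\partial u^j\partial u^l},\qquad 1\le i,j,k,l\le N.$$ Then $\Phi$ locally defines a unique up to motions $N$-dimensional submanifold with flat normal bundle in a $2N$-dimensional pseudo-Euclidean space, with the first fundamental form $\eta_{ij}du^idu^j$ (so the submanifold is flat) and the second fundamental forms $$\omega_n(u)=\frac{\partial^3\Phi}{\partial u^n\partial u^i\partial u^j}du^idu^j,\qquad 1\le n\le N.$$ The signature of the ambient pseudo-Euclidean space is completely determined by the signature of $\eta_{ij}$. In particular, every $N$-dimensional Frobenius manifold can be locally presented by such a flat $N$-dimensional submanifold with flat normal bundle in a $2N$-dimensional pseudo-Euclidean space, the submanifold being defined uniquely up to motions.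
   Context: All considerations are local. The second fundamental forms $\omega_n$ are taken with respect to a parallel (in the flat normal connection) frame $\mathbf n_1,\dots,\mathbf n_N$ of the normal bundle with constant Gram matrix $\langle\mathbf n_m,\mathbf n_n\rangle=\eta_{mn}$; that is, writing the submanifold as $r(u)$, $\omega_n=\langle \frac{\partial^2r}{\partial u^i\partial u^j},\mathbf n_n\rangle du^idu^j$. ''Motions'' are isometries of the ambient pseudo-Euclidean space. A Frobenius manifold locally carries flat coordinates $u^1,\dots,u^N$ in which its metric is a constant matrix $\eta_{ij}$ and a potential $\Phi(u)$ solving the displayed equations of associativity, such that the Frobenius algebra structure on each tangent space is $e_i*e_j=\eta^{ks}\frac{\partial^3\Phi}{\partial u^s\partial u^i\partial u^j}e_k$, $\langle e_i,e_j\rangle=\eta_{ij}$ (with additional conditions such as existence of a unit and quasihomogeneity); the submanifold presenting the Frobenius manifold is the one defined by this $\Phi$. *)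

(* Defs.v *)
From HB Require Import structures.
From mathcomp Require Import all_boot all_order all_algebra.
From mathcomp Require Import all_classical all_reals all_analysis.

Set Implicit Arguments.
Unset Strict Implicit.
Unset Printing Implicit Defensive.

Import Order.TTheory GRing.Theory Num.Theory.
Import numFieldNormedType.Exports.

Local Open Scope classical_set_scope.
Local Open Scope ring_scope.

(* Points and tangent vectors are row vectors; the coordinate u^i is u 0 i.   *)

(* ---- Calculus on open subsets of R^N ------------------------------------- *)

Definition partial (R : realType) (N : nat) (W : normedModType R) (i : 'I_N)
    (f : 'rV[R]_N -> W) : 'rV[R]_N -> W :=
  fun u => 'D_(delta_mx 0 i) f u.

Definition iter_partial (R : realType) (N : nat) (W : normedModType R)
    (s : seq 'I_N) (f : 'rV[R]_N -> W) : 'rV[R]_N -> W :=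
  foldr (fun i g => partial i g) f s.

(* C^oo: all iterated partial derivatives exist and are continuous on V. *)
Definition smooth_on (R : realType) (N : nat) (W : normedModType R)
    (V : set 'rV[R]_N) (f : 'rV[R]_N -> W) : Prop :=
  forall (s : seq 'I_N) (u : 'rV[R]_N), V u ->
    {for u, continuous (iter_partial s f)} /\
    forall i : 'I_N, derivable (iter_partial s f) u (delta_mx 0 i).

Definition partial3 (R : realType) (N : nat) (Phi : 'rV[R]_N -> R)
    (i j k : 'I_N) : 'rV[R]_N -> R :=
  partial i (partial j (partial k Phi)).

(* ---- Pseudo-Euclidean spaces --------------------------------------------- *)

(* A D-dimensional pseudo-Euclidean space is R^D with a nondegenerate         *)
(* symmetric Gram matrix G of arbitrary signature.                            *)
Definition pseudo_euclidean (R : realType) (D : nat) (G : 'M[R]_D) : Prop :=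
  G^T = G /\ G \in unitmx.

Definition scal (R : realType) (D : nat) (G : 'M[R]_D) (x y : 'rV[R]_D) : R :=
  (x *m G *m y^T) 0 0.

Definition std_form (R : realType) (D p : nat) : 'M[R]_D :=
  diag_mx (\row_(i < D) if (i < p)%N then 1 else -1).

(* G has p positive and q negative squares. *)
Definition has_signature (R : realType) (D : nat) (G : 'M[R]_D) (p q : nat)
    : Prop :=
  (p + q = D)%N /\
  exists2 P : 'M[R]_D, P \in unitmx & P *m G *m P^T = std_form R D p.

(* Isometries: bijections preserving the scalar square of differences.        *)
Definition motion (R : realType) (D : nat) (G : 'M[R]_D)
    (f : 'rV[R]_D -> 'rV[R]_D) : Prop :=
  bijective f /\
  forall x y, scal G (f x - f y) (f x - f y) = scal G (x - y) (x - y).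

(* ---- Intrinsic flatness --------------------------------------------------- *)

(* christoffel g k i j is Gamma^k_{ij} of the metric g.                       *)
Definition christoffel (R : realType) (N : nat) (g : 'rV[R]_N -> 'M[R]_N)
    (k i j : 'I_N) (u : 'rV[R]_N) : R :=
  2^-1 * \sum_(l < N) invmx (g u) k l *
    (partial i (fun v => g v l j) u + partial j (fun v => g v l i) u
     - partial l (fun v => g v i j) u).

(* riemann g l k i j is R^l_{kij}, the l-th component of R(d_i, d_j) d_k.     *)
Definition riemann (R : realType) (N : nat) (g : 'rV[R]_N -> 'M[R]_N)
    (l k i j : 'I_N) (u : 'rV[R]_N) : R :=
  partial i (christoffel g l j k) u - partial j (christoffel g l i k) u
  + \sum_(m < N) (christoffel g l i m u * christoffel g m j k u
                  - christoffel g l j m u * christoffel g m i k u).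

Definition flat_metric (R : realType) (N : nat) (V : set 'rV[R]_N)
    (g : 'rV[R]_N -> 'M[R]_N) : Prop :=
  forall (l k i j : 'I_N) u, V u -> riemann g l k i j u = 0.

(* ---- Submanifolds r : V -> R^D -------------------------------------------- *)

(* Row i is d_i r. (The library's 'J is the matrix of the Frechet             *)
(* differential, with which this agrees for smooth r.)                        *)
Definition tangent_frame (R : realType) (N D : nat)
    (r : 'rV[R]_N -> 'rV[R]_D) (u : 'rV[R]_N) : 'M[R]_(N, D) :=
  \matrix_(i < N) partial i r u.

Definition immersion (R : realType) (N D : nat) (V : set 'rV[R]_N)
    (r : 'rV[R]_N -> 'rV[R]_D) : Prop :=
  smooth_on V r /\ forall u, V u -> row_free (tangent_frame r u).

(* An immersion that is a homeomorphism onto its image.                       *)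
Definition embedding (R : realType) (N D : nat) (V : set 'rV[R]_N)
    (r : 'rV[R]_N -> 'rV[R]_D) : Prop :=
  [/\ immersion V r,
      set_inj V r &
      forall A, open A -> A `<=` V ->
        exists2 B, open B & r @` A = r @` V `&` B].

Definition first_form (R : realType) (N D : nat) (G : 'M[R]_D)
    (r : 'rV[R]_N -> 'rV[R]_D) (u : 'rV[R]_N) : 'M[R]_N :=
  \matrix_(i, j) scal G (partial i r u) (partial j r u).

Definition second_form (R : realType) (N D : nat) (G : 'M[R]_D)
    (r xi : 'rV[R]_N -> 'rV[R]_D) (u : 'rV[R]_N) : 'M[R]_N :=
  \matrix_(i, j) scal G (partial i (partial j r) u) (xi u).

Definition normal_field (R : realType) (N D : nat) (G : 'M[R]_D)
    (V : set 'rV[R]_N) (r xi : 'rV[R]_N -> 'rV[R]_D) : Prop :=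
  smooth_on V xi /\
  forall u, V u -> forall i : 'I_N, scal G (xi u) (partial i r u) = 0.

(* Orthogonal projection of v onto the normal space at r(u):                  *)
(* v - sum_(i,j) <v, r_i> g^{ij} r_j.                                         *)
Definition normal_proj (R : realType) (N D : nat) (G : 'M[R]_D)
    (r : 'rV[R]_N -> 'rV[R]_D) (u : 'rV[R]_N) (v : 'rV[R]_D) : 'rV[R]_D :=
  let J := tangent_frame r u in
  v - v *m G *m J^T *m invmx (first_form G r u) *m J.

Definition normal_connection (R : realType) (N D : nat) (G : 'M[R]_D)
    (r : 'rV[R]_N -> 'rV[R]_D) (i : 'I_N) (xi : 'rV[R]_N -> 'rV[R]_D)
    : 'rV[R]_N -> 'rV[R]_D :=
  fun u => normal_proj G r u (partial i xi u).

(* Vanishing curvature of the normal connection; coordinate vector fields     *)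
(* commute, so there is no bracket term.                                      *)
Definition flat_normal_bundle (R : realType) (N D : nat) (G : 'M[R]_D)
    (V : set 'rV[R]_N) (r : 'rV[R]_N -> 'rV[R]_D) : Prop :=
  forall xi, normal_field G V r xi -> forall (i j : 'I_N) u, V u ->
    normal_connection G r i (normal_connection G r j xi) u
    = normal_connection G r j (normal_connection G r i xi) u.

(* The codimension is N, so N normal fields with nondegenerate Gram matrix    *)
(* form a frame of the normal bundle.                                         *)
Record parallel_normal_frame (R : realType) (N : nat) (G : 'M[R]_(N + N))
    (eta : 'M[R]_N) (V : set 'rV[R]_N) (r : 'rV[R]_N -> 'rV[R]_(N + N))
    (n : 'I_N -> 'rV[R]_N -> 'rV[R]_(N + N)) : Prop := {
  frame_normal : forall m, normal_field G V r (n m);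
  frame_parallel : forall i m u, V u -> normal_connection G r i (n m) u = 0;
  frame_gram : forall m k u, V u -> scal G (n m u) (n k u) = eta m k
}.

(* ---- Submanifolds defined by a potential ---------------------------------- *)

Definition associativity_equations (R : realType) (N : nat)
    (U : set 'rV[R]_N) (eta : 'M[R]_N) (Phi : 'rV[R]_N -> R) : Prop :=
  forall u, U u -> forall i j k l : 'I_N,
    \sum_(m < N) \sum_(n < N)
      invmx eta m n * partial3 Phi i j m u * partial3 Phi n k l u
    = \sum_(m < N) \sum_(n < N)
      invmx eta m n * partial3 Phi i k m u * partial3 Phi n j l u.

(* r : V -> (R^(2N), G) is a flat submanifold with flat normal bundle whose   *)
(* fundamental forms are those prescribed by eta and Phi.                     *)
Record realizes (R : realType) (N : nat) (G : 'M[R]_(N + N))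
    (eta : 'M[R]_N) (Phi : 'rV[R]_N -> R) (V : set 'rV[R]_N)
    (r : 'rV[R]_N -> 'rV[R]_(N + N)) : Prop := {
  realizes_immersion : immersion V r;
  realizes_first_form : forall u, V u -> first_form G r u = eta;
  realizes_flat : flat_metric V (first_form G r);
  realizes_flat_normal_bundle : flat_normal_bundle G V r;
  realizes_second_forms :
    exists2 n, parallel_normal_frame G eta V r n &
      forall k u, V u ->
        second_form G r (n k) u = \matrix_(i, j) partial3 Phi k i j u
}.

Definition locally_realizable (R : realType) (N : nat) (G : 'M[R]_(N + N))
    (eta : 'M[R]_N) (Phi : 'rV[R]_N -> R) (U : set 'rV[R]_N)
    (u0 : 'rV[R]_N) : Prop :=
  exists (V : set 'rV[R]_N) (r : 'rV[R]_N -> 'rV[R]_(N + N)),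
    [/\ open_nbhs u0 V, V `<=` U, realizes G eta Phi V r & embedding V r].

(* Local existence near every point in some 2N-dimensional pseudo-Euclidean   *)
(* space.                                                                     *)
Definition local_existence (R : realType) (N : nat) (U : set 'rV[R]_N)
    (eta : 'M[R]_N) (Phi : 'rV[R]_N -> R) : Prop :=
  exists2 G : 'M[R]_(N + N), pseudo_euclidean G &
    forall u0, U u0 -> locally_realizable G eta Phi U u0.

(* If eta has signature (p, q), then the ambient spaces that admit such a     *)
(* submanifold are exactly those of signature (2p, 2q).                       *)
Definition ambient_signature (R : realType) (N : nat) (U : set 'rV[R]_N)
    (eta : 'M[R]_N) (Phi : 'rV[R]_N -> R) : Prop :=
  forall p q : nat, has_signature eta p q ->
  forall G : 'M[R]_(N + N), pseudo_euclidean G ->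
  forall u0, U u0 ->
    (locally_realizable G eta Phi U u0 <-> has_signature G (p + p) (q + q)).

Definition uniqueness_up_to_motions (R : realType) (N : nat)
    (U : set 'rV[R]_N) (eta : 'M[R]_N) (Phi : 'rV[R]_N -> R) : Prop :=
  forall G : 'M[R]_(N + N), pseudo_euclidean G ->
  forall (V : set 'rV[R]_N) (r1 r2 : 'rV[R]_N -> 'rV[R]_(N + N)),
    open V -> connected V -> V `<=` U ->
    realizes G eta Phi V r1 -> realizes G eta Phi V r2 ->
    exists2 f, motion G f & forall u, V u -> r2 u = f (r1 u).

(* ---- Frobenius manifolds --------------------------------------------------- *)

Record frobenius_algebra (R : realType) (N : nat) (eta : 'M[R]_N)
    (mul : 'rV[R]_N -> 'rV[R]_N -> 'rV[R]_N) (e : 'rV[R]_N) : Prop := {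
  fa_linear : forall (a : R) x y z,
    mul (a *: x + y) z = a *: mul x z + mul y z;
  fa_comm : commutative mul;
  fa_assoc : associative mul;
  fa_unit : left_id e mul;
  fa_nondeg : pseudo_euclidean eta;
  fa_invariant : forall x y z, scal eta (mul x y) z = scal eta x (mul y z)
}.

(* A Frobenius manifold (Dubrovin) of dimension N and charge d, read in flat  *)
(* coordinates on an open set. The unit field is covariantly constant, hence  *)
(* constant; the Euler field E satisfies nabla nabla E = 0, hence is affine:  *)
(* E(u) = u Q + b. The associativity equations for the potential are          *)
(* equivalent to associativity of the multiplication.                         *)
Record frobenius_manifold (R : realType) (N : nat) := {
  fm_dom : set 'rV[R]_N;
  fm_eta : 'M[R]_N;
  fm_pot : 'rV[R]_N -> R;
  fm_mul : 'rV[R]_N -> 'rV[R]_N -> 'rV[R]_N -> 'rV[R]_N;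
  fm_unit : 'rV[R]_N;
  fm_Q : 'M[R]_N;
  fm_b : 'rV[R]_N;
  fm_d : R;
  fm_open : open fm_dom;
  fm_smooth : smooth_on fm_dom fm_pot;
  fm_algebra : forall u, fm_dom u ->
    frobenius_algebra fm_eta (fm_mul u) fm_unit;
  fm_structure : forall u, fm_dom u -> forall i j : 'I_N,
    fm_mul u (delta_mx 0 i) (delta_mx 0 j)
    = \sum_(k < N) \sum_(s < N)
        (invmx fm_eta k s * partial3 fm_pot s i j u) *: delta_mx 0 k;
  (* Lie_E e = - e, i.e. [e, E] = e *)
  fm_euler_unit : fm_unit *m fm_Q = fm_unit;
  (* Lie_E <,> = (2 - d) <,> *)
  fm_euler_metric : fm_Q *m fm_eta + fm_eta *m fm_Q^T = (2 - fm_d) *: fm_eta;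
  (* Lie_E Phi = (3 - d) Phi + (a polynomial of degree at most 2) *)
  fm_quasihomogeneous :
    exists (A : 'M[R]_N) (B : 'rV[R]_N) (c : R), forall u, fm_dom u ->
      \sum_(k < N) (u *m fm_Q + fm_b) 0 k * partial k fm_pot u
      = (3 - fm_d) * fm_pot u + (u *m A *m u^T) 0 0 + (u *m B^T) 0 0 + c
}.

(* Main.v *)
Require Import Defs.
From HB Require Import structures.
From mathcomp Require Import all_boot all_order all_algebra.
From mathcomp Require Import all_classical all_reals all_analysis.
From mathcomp Require Import perm ring lra zify.
Import Order.TTheory GRing.Theory Num.Theory.
Import numFieldNormedType.Exports.
Local Open Scope classical_set_scope.
Local Open Scope ring_scope.

Set Implicit Arguments.
Unset Strict Implicit.
Unset Printing Implicit Defensive.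

(* Let T and n be the N x 2N matrices whose rows are the tangent vectors d_i r
   and the normals n_k, and let P be T stacked on n. The Gauss and Weingarten
   equations of a submanifold with the prescribed fundamental forms read
   d_i P = A_i P with A_i = [[0, M_i], [- M_i, 0]], M_i = (Phi_ijk)_jk eta^-1.
   The M_i du^i are closed because they are made of third derivatives, and the
   M_i commute by associativity, so A_i A_j = A_j A_i and d_j A_i = d_i A_j.
   Hence the Picard iteration for dP = A P only integrates closed 1-forms and
   converges near any point. Since A_i is skew for G0 = diag(eta, eta), the
   matrix G P^T G0^-1 satisfies the dual system: it remains inverse to P, which
   keeps P G P^T = G0 (existence, and G is congruent to G0), and the product of
   the inverse of one frame with another one is constant (uniqueness). *)

(** * Differential calculus along coordinate boxes *)

(** The diagonal blocks of A_i vanish because the metric is constant, so there are no Christoffel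
    symbols, and because the normal frame is parallel. As A_i A_j = - diag(M_i M_j, M_i M_j), a
    single commutation relation is both the Gauss and the Ricci equation, while closedness is the
    Codazzi equation. Both halves of the frame have the same Gram matrix eta, and this makes A_i
    skew and doubles the signature. Derivatives are given only along coordinate directions. The
    calculus of several variables (C^1 functions, symmetry of second derivatives, the Poincare
    lemma) is therefore derived from the one-variable mean value theorem along the edges of boxes. A
    limit of Picard iterates is at first only C^1; its smoothness is recovered from the equation
    that it solves. Uniqueness also needs the converse passage: the prescribed forms force the Gauss
    and Weingarten equations on every realization. *)

Definition between (R : realType) (a b x : R) := Num.min a b <= x <= Num.max a b.

Lemma between_le (R : realType) (a b x : R) : a <= b ->
  between a b x = (a <= x <= b).
Proof. by move=> ab; rewrite /between (min_l ab) (max_r ab). Qed.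

Lemma between_ball (R : realType) (c r a b x : R) :
  ball c r a -> ball c r b -> between a b x -> ball c r x.
Proof.
rewrite /ball /= /between !ltr_distlC => /andP[a1 a2] /andP[b1 b2].
by rewrite ge_min le_max => /andP[/orP[] ? /orP[] ?]; lra.
Qed.

Lemma between_dist (R : realType) (a b x : R) :
  between a b x -> `|x - a| <= `|b - a|.
Proof.
rewrite /between; case: (leP a b) => ab /andP[ax xb].
  by rewrite !ger0_norm ?subr_ge0 // lerD2r.
by rewrite !ler0_norm ?subr_le0 ?(ltW ab) // lerN2 lerD2r.
Qed.

(** The criterion has no quotient: the remainder is estimated directly, and h = 0 needs no separate
    treatment. *)
Lemma is_derive_eps (R : realType) (V : normedModType R) (f : V -> R)
    (u v : V) (l : R) :
  (forall e : R, 0 < e -> exists2 d : R, 0 < d & forall h : R, `|h| < d ->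
     `|f (h *: v + u) - f u - h * l| <= e * `|h|) ->
  is_derive u v f l.
Proof.
move=> H.
suff C : (fun h => h^-1 *: ((f \o shift u) (h *: v) - f u)) @ 0^' --> l.
  by split; [apply/cvg_ex; exists l | exact/cvg_lim].
apply/cvgrPdist_le => e e0; have [d d0 hd] := H e e0.
near=> h.
have h0 : h != 0 by near: h; exact: nbhs_dnbhs_neq.
have hn : `|h| < d by near: h; exact: dnbhs0_lt.
have {hd} := hd h hn.
change (`|f (h *: v + u) - f u - h * l| <= e * `|h| ->
  `|l - h^-1 * (f (h *: v + u) - f u)| <= e).
rewrite -[X in _ -> `|X - _| <= e](mulKf h0) -mulrBr distrC => hd.
by rewrite normrM normfV ler_pdivrMl ?normr_gt0 // [leRHS]mulrC.
Unshelve. all: by end_near. Qed.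

Lemma is_derive_line (R : realType) (V : normedModType R) (f : V -> R)
    (a v : V) (s l : R) :
  is_derive (a + s *: v) v f l -> is_derive s 1 (fun t => f (a + t *: v)) l.
Proof.
move=> [df dl].
have E : (fun h => h^-1 *: (((fun t => f (a + t *: v)) \o shift s) (h *: 1)
            - f (a + s *: v)))
       = (fun h => h^-1 *: ((f \o shift (a + s *: v)) (h *: v) - f (a + s *: v))).
  apply/funext => h /=; congr (_ *: (f _ - _)).
  by rewrite [h *: 1]mulr1 scalerDl addrCA.
by split; rewrite /derivable /derive /= E.
Qed.

(** The order of the endpoints is left free, since the increments to which this is applied have
    either sign. *)
Lemma mean_value (R : realType) (f df : R -> R) (a b : R) :
  (forall x, between a b x -> is_derive x 1 f (df x)) ->
  exists2 c, between a b c & f b - f a = df c * (b - a).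
Proof.
have core (x y : R) : x <= y ->
    (forall z, x <= z <= y -> is_derive z 1 f (df z)) ->
    exists2 c, x <= c <= y & f y - f x = df c * (y - x).
  move=> xy H.
  have D z : z \in `]x, y[%R -> is_derive z 1 f (df z).
    by rewrite in_itv /= => /andP[? ?]; apply: H; lra.
  have C : {within `[x, y], continuous f}.
    apply: derivable_within_continuous => z; rewrite in_itv /= => zi.
    by have [] := H z zi.
  have [c + Ec] := MVT_segment xy D C.
  by rewrite in_itv /= => ci; exists c.
rewrite /between; case: (leP a b) => ab H; first exact: core.
have [c ci E] := core _ _ (ltW ab) H; exists c => //; lra.
Qed.

Lemma continuous_ball (R : realType) (V W : normedModType R) (f : V -> W) (u : V) :
  {for u, continuous f} <->
  forall e : R, 0 < e -> exists2 r : R, 0 < r &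
    forall w, ball u r w -> `|f w - f u| <= e.
Proof.
split=> [/cvgrPdist_le H e /H /nbhs_ballP[r r0 Hr]|H].
  by exists r => // w /Hr; rewrite /= distrC.
apply/cvgrPdist_le => e /H[r r0 Hr]; apply/nbhs_ballP; exists r => // w /Hr /=.
by rewrite distrC.
Qed.

Section several_variables.
Variables (R : realType) (N : nat).
Local Notation E := 'rV[R]_N.
Local Notation e_ i := (delta_mx 0 i : E).
Implicit Types (u v w a : E) (V : set E).

Definition box u v w := forall i, between (u 0 i) (v 0 i) (w 0 i).

Lemma box_ball a (r : R) u v w : ball a r u -> ball a r v -> box u v w ->
  ball a r w.
Proof.
move=> [r0 au] [_ av] uvw; split=> // i j; rewrite !ord1.
exact: between_ball (au 0 j) (av 0 j) (uvw j).
Qed.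

(** A staircase path from [u] to [v] changes one coordinate at a time. The increments along its
    edges telescope, and the one-variable theorem applies on each edge, so partial derivatives
    suffice. *)
Lemma box_mean_value (f : E -> R) (g : 'I_N -> E -> R) u v :
  (forall i w, box u v w -> is_derive w (e_ i) f (g i w)) ->
  exists2 xi : 'I_N -> E, forall i, box u v (xi i) &
    f v - f u = \sum_i (v 0 i - u 0 i) * g i (xi i).
Proof.
move=> H.
(* [w k] is the corner whose first [k] coordinates are already those of [v]; [p i s] runs along the
   edge that starts there, with [s] as its [i]-th coordinate. *)
pose w k : E := \row_j (if (j < k)%N then v 0 j else u 0 j).
pose p (i : 'I_N) (s : R) : E := w i + (s - u 0 i) *: e_ i.
have pE i s : p i s = p i 0 + s *: e_ i.
  by rewrite /p sub0r scaleNr scalerBl addrA addrAC.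
have wS (i : 'I_N) : w i.+1 = p i (v 0 i).
  apply/rowP => j; rewrite !mxE eqxx /= ltnS leq_eqVlt val_eqE [j == i]eq_sym.
  case: eqVneq => [->|_] /=; last by rewrite mulr0 addr0.
  by rewrite ltnn mulr1 subrKC.
have pw i : p i (u 0 i) = w i by rewrite /p subrr scale0r addr0.
have pbox i s : between (u 0 i) (v 0 i) s -> box u v (p i s).
  move=> si j; rewrite !mxE eqxx /= eq_sym; case: eqVneq => [<-|_] /=.
    by rewrite ltnn mulr1 subrKC.
  rewrite mulr0 addr0; case: ifP => _; rewrite /between;
    by rewrite ge_min le_max !lexx ?orbT.
have /choice[c cP] i : exists c, between (u 0 i) (v 0 i) c /\
    f (w i.+1) - f (w i) = (v 0 i - u 0 i) * g i (p i c).
  have [s si|c ci Ec] := @mean_value R (f \o p i) (fun s => g i (p i s))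
      (u 0 i) (v 0 i).
    rewrite (_ : f \o p i = fun t => f (p i 0 + t *: e_ i)); last first.
      by apply/funext => t /=; rewrite pE.
    by apply: is_derive_line; rewrite -pE; apply: H; apply: pbox.
  by exists c; split=> //; rewrite wS -pw mulrC -Ec.
exists (fun i => p i (c i)) => [i|]; first by apply: pbox; have [] := cP i.
under eq_bigr => i _ do rewrite -(proj2 (cP i)).
rewrite -(big_mkord xpredT (fun i => f (w i.+1) - f (w i))) telescope_sumr //.
congr (f _ - f _); apply/rowP => j; first by rewrite mxE ltn_ord.
by rewrite mxE.
Qed.

Lemma near_all_ball (V : set E) (u : E) (I : finType) (g : I -> E -> R) (e : R) :
  open V -> V u -> (forall i, {for u, continuous (g i)}) -> 0 < e ->
  exists2 r : R, 0 < r &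
    forall w, ball u r w -> V w /\ forall i, `|g i w - g i u| < e.
Proof.
move=> oV Vu gc e0.
have : \forall w \near u, V w /\ forall i, `|g i w - g i u| < e.
  apply: filterI; first exact: open_nbhs_nbhs.
  apply: (@filter_forall _ I (fun i w => `|g i w - g i u| < e) (nbhs u)) => i.
  have /cvgrPdist_lt/(_ _ e0) := gc i.
  by apply: filterS => w; rewrite distrC.
by move=> /nbhs_ballP[r r0 H]; exists r => // w /H.
Qed.

(** The partial derivatives are data, so that they may be given by any formula, such as an entry of
    a matrix product. *)
Definition C1_on (V : set E) (f : E -> R) (g : 'I_N -> E -> R) :=
  forall i u, V u -> is_derive u (e_ i) f (g i u) /\ {for u, continuous (g i)}.

(** In the box mean value formula every partial is taken close to [u], hence differs from its value
    at [u] by less than [e / S], where [S] exceeds the sum of the |v_i|. *)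
Lemma C1_on_line V f g u v : open V -> C1_on V f g -> V u ->
  is_derive u v f (\sum_i v 0 i * g i u).
Proof.
move=> oV fg Vu; apply: is_derive_eps => e e0.
pose S := 1 + \sum_i `|v 0 i|.
have S0 : 0 < S by rewrite ltr_pwDl // sumr_ge0.
have [r r0 H] := near_all_ball oV Vu (fun i => (fg i u Vu).2) (divr_gt0 e0 S0).
exists (r / (1 + `|v|)) => [|h hr]; first by rewrite divr_gt0 // ltr_pwDl.
have hv : ball u r (h *: v + u).
  rewrite -ball_normE /ball_ /= opprD addrCA subrr addr0 normrN normrZ.
  have vn : 0 < 1 + `|v| by rewrite ltr_pwDl.
  move: hr; rewrite ltr_pdivlMr //; apply: le_lt_trans.
  by rewrite ler_wpM2l // lerDr.
have bx w : box u (h *: v + u) w -> ball u r w by apply: box_ball => //; exact: ballxx.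
have [xi xiP ->] := box_mean_value (fun i w bw => (fg i w (H w (bx w bw)).1).1).
rewrite mulr_sumr -sumrB; apply: le_trans (ler_norm_sum _ _ _) _.
have -> : e * `|h| = e / S * (`|h| * S) by field; rewrite gt_eqF.
apply: (@le_trans _ _ (\sum_i e / S * (`|h| * `|v 0 i|))); last first.
  rewrite -mulr_sumr -mulr_sumr (ler_wpM2l (ltW (divr_gt0 e0 S0))) //.
  by rewrite ler_wpM2l // lerDr.
apply: ler_sum => i _; rewrite !mxE addrK mulrA -mulrBr !normrM mulrC.
by rewrite ler_wpM2r ?mulr_ge0 // ltW // (H _ (bx _ (xiP i))).2.
Qed.

Lemma C1_on_continuous V f g u : open V -> C1_on V f g -> V u ->
  {for u, continuous f}.
Proof.
move=> oV fg Vu; apply/continuous_ball => e e0.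
have [r r0 H] := near_all_ball oV Vu (fun i => (fg i u Vu).2) ltr01.
pose S := 1 + \sum_i (1 + `|g i u|).
have S0 : 0 < S by rewrite ltr_pwDl // sumr_ge0 // => i _; rewrite addr_ge0.
exists (Num.min r (e / S)) => [|w uw]; first by rewrite lt_min r0 divr_gt0.
have urw : ball u r w by apply: le_ball uw; rewrite ge_min lexx.
have bx z : box u w z -> ball u r z by apply: box_ball => //; exact: ballxx.
have [xi xiP ->] := box_mean_value (fun i z bz => (fg i z (H z (bx z bz)).1).1).
apply: le_trans (ler_norm_sum _ _ _) _.
have uwe : ball u (e / S) w by apply: le_ball uw; rewrite ge_min lexx orbT.
apply: (@le_trans _ _ (\sum_i e / S * (1 + `|g i u|))); last first.
  by rewrite -mulr_sumr mulrAC ler_pdivrMr // (ler_wpM2l (ltW e0)) // lerDr.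
apply: ler_sum => i _; rewrite normrM ler_pM //.
  by case: uwe => _ /(_ 0 i); rewrite /ball /= distrC => /ltW.
rewrite -[g i (xi i)](subrK (g i u)); apply: le_trans (ler_normD _ _) _.
by rewrite lerD2r ltW // (H _ (bx _ (xiP i))).2.
Qed.

(** The second difference of [f] over a small square with corner [u] does not depend on the order of
    the directions. Two applications of the mean value theorem, in each order, express it as h^2
    times either mixed derivative at a point near [u]. *)
Lemma schwarz V (f : E -> R) (fi fj fij fji : E -> R) (i j : 'I_N) (u : E) :
  open V -> V u ->
  (forall w, V w -> is_derive w (e_ i) f (fi w)) ->
  (forall w, V w -> is_derive w (e_ j) f (fj w)) ->
  (forall w, V w -> is_derive w (e_ j) fi (fij w)) ->
  (forall w, V w -> is_derive w (e_ i) fj (fji w)) ->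
  {for u, continuous fij} -> {for u, continuous fji} ->
  fij u = fji u.
Proof.
move=> oV Vu Hi Hj Hij Hji cij cji.
apply/eqP; rewrite -subr_eq0 -normr_le0; apply/ler_addgt0Pl => e e0; rewrite addr0.
have e20 : 0 < e / 2 by rewrite divr_gt0.
have [r r0 H] := @near_all_ball V u bool (fun b => if b then fij else fji) _
  oV Vu (fun b => match b with true => cij | false => cji end) e20.
(* Coordinate vectors have norm at most 1, so the square stays within distance r / 2 of [u]. *)
pose h := r / 4.
have h0 : 0 < h by rewrite divr_gt0.
have bE s : between 0 h s = (0 <= s <= h).
  by rewrite between_le // ltW.
have step (k l : 'I_N) (s t : R) : between 0 h s -> between 0 h t ->
    ball u r (u + s *: e_ k + t *: e_ l).
  rewrite !bE => /andP[s0 sh] /andP[t0 th].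
  rewrite -ball_normE /ball_ /= -addrA opprD addrA subrr sub0r normrN.
  have de (m : 'I_N) : `|e_ m| <= 1.
    rewrite /Num.Def.normr /= mx_normrE; apply/bigmax_leP; split=> // -[a b] _ /=.
    by rewrite mxE ord1 eqxx /=; case: eqP => _; rewrite ?normr1 ?normr0.
  apply: le_lt_trans (ler_normD _ _) _; rewrite !normrZ.
  have sk := ler_wpM2l (normr_ge0 s) (de k).
  have tl := ler_wpM2l (normr_ge0 t) (de l).
  rewrite mulr1 ger0_norm // in sk; rewrite mulr1 ger0_norm // in tl.
  rewrite !ger0_norm //; apply: le_lt_trans (lerD sk tl) _.
  by rewrite /h in sh th; lra.
have b0 : between 0 h 0 by rewrite bE lexx ltW.
have bh : between 0 h h by rewrite bE lexx ltW.
have core (k l : 'I_N) (fk fkl : E -> R) :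
    (forall w, V w -> is_derive w (e_ k) f (fk w)) ->
    (forall w, V w -> is_derive w (e_ l) fk (fkl w)) ->
    exists2 xi, ball u r xi &
      f (u + h *: e_ k + h *: e_ l) - f (u + h *: e_ k) - f (u + h *: e_ l) + f u
      = fkl xi * h * h.
  move=> Hk Hkl.
  have sw (s t : R) : u + s *: e_ k + t *: e_ l = u + t *: e_ l + s *: e_ k.
    by rewrite addrAC.
  have inV (s t : R) : between 0 h s -> between 0 h t ->
      V (u + s *: e_ k + t *: e_ l) by move=> sP tP; have [] := H _ (step k l _ _ sP tP).
  have line0 s : u + s *: e_ k = u + s *: e_ k + 0 *: e_ l by rewrite scale0r addr0.
  have [s sP Es] := @mean_value R
    (fun s => f (u + h *: e_ l + s *: e_ k) - f (u + s *: e_ k))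
    (fun s => fk (u + h *: e_ l + s *: e_ k) - fk (u + s *: e_ k)) 0 h
    (fun s sP => is_deriveB
       (is_derive_line (Hk (u + h *: e_ l + s *: e_ k)
          (eq_ind _ V (inV s h sP bh) _ (sw _ _))))
       (is_derive_line (Hk (u + s *: e_ k)
          (eq_ind_r V (inV s 0 sP b0) (line0 s))))).
  have [t tP Et] := @mean_value R
    (fun t => fk (u + s *: e_ k + t *: e_ l))
    (fun t => fkl (u + s *: e_ k + t *: e_ l)) 0 h
    (fun t tP => is_derive_line (Hkl _ (inV s t sP tP))).
  exists (u + s *: e_ k + t *: e_ l); first exact: step.
  rewrite !subr0 in Es Et; rewrite -Et -line0 (sw s h) -Es.
  by rewrite scale0r !addr0 (sw h h); ring.
have [x xb Ex] := core i j _ _ Hi Hij; have [y yb Ey] := core j i _ _ Hj Hji.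
have Exy : fij x = fji y.
  have hn : h != 0 by rewrite gt_eqF.
  suff : fij x * h * h = fji y * h * h by move/(mulIf hn)/(mulIf hn).
  rewrite -Ex -Ey; have -> : u + h *: e_ j + h *: e_ i = u + h *: e_ i + h *: e_ j.
    by rewrite addrAC.
  by ring.
have := (H x xb).2 true; have := (H y yb).2 false; rewrite /= Exy.
rewrite !ltr_distl ler_norml => /andP[? ?] /andP[? ?]; apply/andP; split; lra.
Qed.

End several_variables.

(** * The Poincare lemma *)

(** Integrating from -1 and stopping at 2 gives two-sided derivatives on all of [0, 1], endpoints
    included. *)
Lemma ex_primitive (R : realType) (phi : R -> R) : continuous phi ->
  exists2 P : R -> R, P 0 = 0 & forall t : R, -1 < t < 2 -> is_derive t 1 P (phi t).
Proof.
move=> cphi.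
pose F x := (\int[@lebesgue_measure R]_(t in [set` `[(-1)%R, x]]) phi t)%R.
have int : (@lebesgue_measure R).-integrable `[(-1)%R, 2%R] (EFin \o phi).
  apply: continuous_compact_integrable; first exact: segment_compact.
  exact: continuous_subspaceT.
exists (fun t => F t - F 0) => [|t /andP[t1 t2]]; first by rewrite subrr.
have [D FE] := continuous_FTC1_closed t2 int t1 (cphi t).
have DF : is_derive t 1 F (phi t) by split=> //; rewrite -derive1E.
by apply: is_derive_eq; rewrite subr0.
Qed.

Lemma continuous_sum (R : realType) (T : topologicalType) (I : Type)
    (r : seq I) (f : I -> T -> R) (x : T) :
  (forall i, {for x, continuous (f i)}) ->
  {for x, continuous (fun y => \sum_(i <- r) f i y)}.
Proof. by move=> fc; apply: cvg_big => [|i _]; [exact: add_continuous | exact: fc]. Qed.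

Section linear_systems.
Variables (R : realType) (N : nat).
Local Notation E := 'rV[R]_N.
Local Notation e_ i := (delta_mx 0 i : E).
Implicit Types (u v w x : E).

Lemma ball_ray (c u : E) (r t : R) : ball c r u -> 0 <= t <= 1 ->
  ball c r (c + t *: (u - c)).
Proof.
rewrite -!ball_normE /ball_ /= => cu /andP[t0 t1].
rewrite opprD addrA subrr sub0r normrN normrZ ger0_norm // distrC.
by apply: le_lt_trans cu; rewrite ler_piMl.
Qed.

(** Composition with [clamp] extends a function continuous on [0, 1] to the whole line: the rays
    used below stay in the ball only for times in [0, 1]. *)
Definition clamp (t : R) : R := Num.max 0 (Num.min t 1).

Lemma clamp_id (t : R) : 0 <= t <= 1 -> clamp t = t.
Proof. by move=> /andP[t0 t1]; rewrite /clamp min_l // max_r. Qed.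

Lemma clamp_itv (t : R) : 0 <= clamp t <= 1.
Proof.
by rewrite /clamp le_max lexx /= ge_max ler01 /= ge_min lexx orbT.
Qed.

Lemma clamp_continuous : continuous clamp.
Proof.
move=> t; have id_min : {for t, continuous ((id : R -> R^o) \min cst 1)}.
  by apply: continuous_min; [exact: cvg_id | exact: cvg_cst].
by have := continuous_max (@cst_continuous R R^o 0 t) id_min.
Qed.

Lemma line_continuous (a v : E) (f : E -> R) (t : R) :
  {for (a + t *: v), continuous f} ->
  {for t, continuous (fun s : R => f (a + s *: v))}.
Proof.
move=> fc; apply: (@continuous_comp R E R (fun s : R => a + s *: v) f) => //.
by apply: cvgD; [exact: cvg_cst | exact: scalel_continuous].
Qed.

(* The modulus of continuity is uniform along the segment, by compactness. *)
Lemma uniform_on_segment (V : set E) (a v : E) (k : 'I_N) (I : finType)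
    (g : I -> E -> R) (e : R) : open V ->
  (forall i w, V w -> {for w, continuous (g i)}) ->
  (forall t : R, 0 <= t <= 1 -> V (a + t *: v)) -> 0 < e ->
  exists2 d : R, 0 < d & forall t s : R, 0 <= t <= 1 -> `|s| < d ->
    V (a + t *: v + s *: e_ k) /\
    forall i, `|g i (a + t *: v + s *: e_ k) - g i (a + t *: v)| <= e.
Proof.
move=> oV gc aV e0.
have := @segment_compact R 0 1; move=> /compact_near_coveringP.
move/(_ _ (nbhs (0 : R)) (fun s t => V (a + t *: v + s *: e_ k) /\
    forall i, `|g i (a + t *: v + s *: e_ k) - g i (a + t *: v)| <= e)).
case=> [t|d /= d0 H].
  rewrite /= in_itv /= => t01.
  have Vt := aV t t01.
  have e20 : 0 < e / 2 by rewrite divr_gt0.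
  have [r r0 Hr] := near_all_ball oV Vt (fun i => gc i _ Vt) e20.
  pose d := r / 2 / (1 + `|v| + `|e_ k|).
  have S0 : 0 < 1 + `|v| + `|e_ k| by rewrite -addrA ltr_pwDl // addr_ge0.
  have d0 : 0 < d by rewrite !divr_gt0.
  exists (ball t d, ball 0 d) => /=; first by split; exact: nbhsx_ballx.
  move=> [t' s] /= []; rewrite /ball /= sub0r normrN => tt' s0.
  have b1 : `|t - t'| * `|v| < r / 2.
    apply: (@le_lt_trans _ _ (`|t - t'| * (1 + `|v| + `|e_ k|))).
      by rewrite ler_wpM2l // addrAC lerDr addr_ge0.
    by rewrite -ltr_pdivlMr.
  have b2 : `|s| * `|e_ k| < r / 2.
    apply: (@le_lt_trans _ _ (`|s| * (1 + `|v| + `|e_ k|))).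
      by rewrite ler_wpM2l // lerDr addr_ge0.
    by rewrite -ltr_pdivlMr.
  have B1 : ball (a + t *: v) r (a + t' *: v).
    rewrite -ball_normE /ball_ /= opprD addrACA subrr add0r -scalerBl normrZ; lra.
  have B2 : ball (a + t *: v) r (a + t' *: v + s *: e_ k).
    rewrite -ball_normE /ball_ /= opprD addrA opprD addrACA subrr add0r -scalerBl.
    by apply: le_lt_trans (ler_normB _ _) _; rewrite !normrZ; lra.
  split; first by have [] := Hr _ B2.
  move=> i; have := (Hr _ B1).2 i; have := (Hr _ B2).2 i.
  rewrite !ltr_distl ler_norml => /andP[? ?] /andP[? ?]; apply/andP; split; lra.
exists d => // t s t01 sd; apply: (H s); last by rewrite /= in_itv.
by rewrite /ball_ /= sub0r normrN.
Qed.

(** The primitive is f(u) = int_0^1 sum_i (u_i - c_i) om_i(c + t (u - c)) dt. Differentiation under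
    the integral is replaced by the mean value theorem in [t], applied to the difference of two such
    integrals with variable upper bound. *)
Lemma poincare (c : E) (r : R) (om : 'I_N -> E -> R)
    (dom : 'I_N -> 'I_N -> E -> R) : 0 < r ->
  (forall i, C1_on (ball c r) (om i) (dom i)) ->
  (forall i j u, ball c r u -> dom i j u = dom j i u) ->
  exists2 f : E -> R, f c = 0 &
    forall u, ball c r u -> forall k, is_derive u (e_ k) f (om k u).
Proof.
move=> r0 omC closed.
have oV : open (ball c r) by exact: ball_open.
have ray u (t : R) : ball c r u -> 0 <= t <= 1 -> ball c r (c + t *: (u - c)).
  exact: ball_ray.
pose phi u t := \sum_i (u 0 i - c 0 i) * om i (c + t *: (u - c)).
have /choice[P PP] u : exists P : R -> R, ball c r u ->
    P 0 = 0 /\ forall t : R, 0 <= t <= 1 -> is_derive t 1 P (phi u t).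
  have [uV|nV] := pselect (ball c r u); last by exists (fun=> 0).
  have [|P P0 PD] := @ex_primitive R (phi u \o clamp).
    move=> t; apply: continuous_comp; first exact: clamp_continuous.
    apply: continuous_sum => i; apply: cvgM; first exact: cvg_cst.
    apply: line_continuous; apply: (C1_on_continuous oV (omC i)).
    by apply: ray => //; exact: clamp_itv.
  exists P => _; split=> // t t01; have [|d dE] := PD t; first by lra.
  by split=> //; rewrite dE /= clamp_id.
exists (fun u => P u 1).
  have c0 : ball c r c by exact: ballxx.
  have [P0 PD] := PP c c0.
  have phi0 t : phi c t = 0.
    by rewrite /phi big1 // => i _; rewrite subrr mul0r.
  have [t|t _] := @mean_value R (P c) (phi c) 0 1.
    by rewrite between_le // => /PD.
  by rewrite P0 phi0 mul0r subr0.
move=> u uV k; apply: is_derive_eps => e e0.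
pose S := 1 + \sum_i `|u 0 i - c 0 i|.
have S0 : 0 < S by rewrite ltr_pwDl // sumr_ge0.
have eS : 0 < e / S by rewrite divr_gt0.
(* [None] stands for [om k] and [Some i] for its companion derivative [dom i k]. A common modulus
   [e / S] is enough: the remainders of the [om i] use up the sum in [S], and the increment of
   [om k] uses its summand 1. *)
have [d d0 Hd] := @uniform_on_segment (ball c r) c (u - c) k
  (option 'I_N) (fun i => if i is Some i then dom i k else om k) (e / S) oV
  (fun i => match i with
    | Some i => fun w wV => (omC i k w wV).2
    | None => fun w wV => C1_on_continuous oV (omC k) wV end)
  (fun t t01 => ray u t uV t01) eS.
exists d => // h hd.
have hk t : c + t *: (h *: e_ k + u - c) = c + t *: (u - c) + (t * h) *: e_ k.
  by rewrite -[h *: _ + u - c]addrA scalerDr scalerA addrCA addrA [_ + c]addrC addrAC.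
have thd (t : R) : 0 <= t <= 1 -> `|t * h| < d.
  move=> /andP[t0 t1]; rewrite normrM ger0_norm //.
  by apply: le_lt_trans hd; rewrite ler_piMl.
have huV : ball c r (h *: e_ k + u).
  have := (Hd 1 h); rewrite !scale1r subrKC addrC ler01 lexx => H.
  by have [] := H isT hd.
have [Pu0 PuD] := PP u uV; have [Ph0 PhD] := PP _ huV.
(* [D] vanishes at 0, and at 1 it is the first-order remainder of the primitive; a bound on its
   derivative [dD] is all that is needed. *)
pose D t := P (h *: e_ k + u) t - P u t - h * (t * om k (c + t *: (u - c))).
pose dD t := phi (h *: e_ k + u) t - phi u t
  - h * (om k (c + t *: (u - c))
         + t * \sum_i (u - c) 0 i * dom k i (c + t *: (u - c))).
have DD (t : R) : 0 <= t <= 1 -> is_derive t 1 D (dD t).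
  move=> t01; have d1 := PhD t t01; have d2 := PuD t t01.
  have d3 : is_derive t 1 (fun s => om k (c + s *: (u - c)))
      (\sum_i (u - c) 0 i * dom k i (c + t *: (u - c))).
    apply: is_derive_line; apply: (C1_on_line _ oV (omC k)); exact: ray.
  have d4 := is_deriveM (is_derive_id t 1) d3.
  have d5 := is_deriveB (is_deriveB d1 d2) (is_deriveZ h d4).
  apply: is_derive_eq d5 _; rewrite /dD; congr (_ - _).
  by rewrite /GRing.scale /= mulr1 addrC.
have bnd (t : R) : 0 <= t <= 1 -> `|dD t| <= e * `|h|.
  move=> t01; have [xV xd] := Hd t (t * h) t01 (thd t t01).
  set x := c + t *: (u - c) in xV xd *.
  (* Closedness enters here: it replaces the derivatives of [om k] along the ray by those of the
     [om i] in direction [k], which leaves only Taylor remainders and one small increment. *)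
  have -> : dD t = \sum_i (u 0 i - c 0 i)
        * (om i (x + (t * h) *: e_ k) - om i x - t * h * dom i k x)
      + h * (om k (x + (t * h) *: e_ k) - om k x).
    rewrite /dD /phi hk -/x.
    have -> : \sum_i ((h *: e_ k + u) 0 i - c 0 i) * om i (x + (t * h) *: e_ k)
        = \sum_i (u 0 i - c 0 i) * om i (x + (t * h) *: e_ k)
          + h * om k (x + (t * h) *: e_ k).
      under eq_bigr => i _ do rewrite !mxE eqxx /= -addrA addrC mulrDl.
      rewrite big_split /=; congr (_ + _); rewrite (bigD1 k) //= eqxx mulr1 big1 ?addr0 // => i ik.
      by rewrite (negPf ik) mulr0 mul0r.
    have -> : \sum_i (u - c) 0 i * dom k i x
        = \sum_i (u 0 i - c 0 i) * dom i k x.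
      by apply: eq_bigr => i _; rewrite !mxE closed //; exact: ray.
    under [in RHS]eq_bigr => i _ do rewrite !mulrBr [X in _ - X]mulrCA.
    by rewrite !sumrB -mulr_sumr; ring.
  have term i : `|om i (x + (t * h) *: e_ k) - om i x - t * h * dom i k x|
      <= `|h| * (e / S).
    have thb (s : R) : between 0 (t * h) s -> `|s| < d.
      move=> /between_dist; rewrite !subr0 => /le_lt_trans; apply; exact: thd.
    have [s sb|s /thb sd Es] := @mean_value R (fun s => om i (x + s *: e_ k))
      (fun s => dom i k (x + s *: e_ k)) 0 (t * h).
      apply: is_derive_line; have [xsV _] := Hd t s t01 (thb s sb).
      by have [] := omC i k _ xsV.
    rewrite scale0r addr0 subr0 in Es; rewrite Es mulrC -mulrBr normrM.
    have [_ /(_ (Some i)) /= Hs] := Hd t s t01 sd.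
    apply: ler_pM => //; have /andP[t0 t1] := t01.
    by rewrite normrM ger0_norm // ler_piMl.
  apply: le_trans (ler_normD _ _) _.
  have -> : e * `|h| = `|h| * (e / S) * \sum_i `|u 0 i - c 0 i| + `|h| * (e / S).
    by rewrite /S in S0 *; field; rewrite gt_eqF.
  apply: lerD; last by rewrite normrM ler_wpM2l //; have := xd None.
  apply: le_trans (ler_norm_sum _ _ _) _; rewrite mulr_sumr.
  by apply: ler_sum => i _; rewrite normrM mulrC ler_wpM2r.
have [t|t] := @mean_value R D dD 0 1; rewrite between_le //; first exact: DD.
move=> t01; rewrite subr0 mulr1 {1 2}/D Pu0 Ph0 !scale1r subrKC mul0r mulr0 mul1r !subr0.
by move=> ->; exact: bnd.
Qed.

End linear_systems.

(** * Entrywise calculus of matrix-valued functions and uniform limits *)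

Section matrix_valued.
Variables (R : realType) (N : nat).
Local Notation E := 'rV[R]_N.
Local Notation e_ i := (delta_mx 0 i : E).
Implicit Types (u v w x : E).

(** Entrywise, so that the scalar calculus applies directly; [mderive_partial] turns it into a value
    of [partial]. *)
Definition mderive m n (F : E -> 'M[R]_(m, n)) u v (D : 'M[R]_(m, n)) :=
  forall a b, is_derive u v (fun x => F x a b) (D a b).

Lemma is_derive_sumf (I : finType) (f : I -> E -> R) u v (df : I -> R) :
  (forall i, is_derive u v (f i) (df i)) ->
  is_derive u v (fun x => \sum_i f i x) (\sum_i df i).
Proof.
move=> H; rewrite (_ : (fun x => _) = \sum_i f i); last first.
  by apply/funext => x; rewrite fct_sumE.
by elim/big_ind2 : _ => [|f1 d1 f2 d2 *|i _]; [exact: is_derive_cst |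
  exact: is_deriveD | exact: H].
Qed.

Lemma mderive_cst m n (C : 'M[R]_(m, n)) u v : mderive (fun=> C) u v 0.
Proof. by move=> a b; rewrite mxE; exact: is_derive_cst. Qed.

Lemma mderiveD m n (F G : E -> 'M[R]_(m, n)) u v DF DG :
  mderive F u v DF -> mderive G u v DG ->
  mderive (fun x => F x + G x) u v (DF + DG).
Proof.
move=> HF HG a b; rewrite mxE; have h := is_deriveD (HF a b) (HG a b).
rewrite (_ : (fun x => _) = (fun x => F x a b) + (fun x => G x a b)); first exact: h.
by apply/funext => x; rewrite mxE.
Qed.

Lemma mderiveN m n (F : E -> 'M[R]_(m, n)) u v DF :
  mderive F u v DF -> mderive (fun x => - F x) u v (- DF).
Proof.
move=> HF a b; rewrite mxE; have h := is_deriveN (HF a b).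
rewrite (_ : (fun x => _) = - (fun x => F x a b)); first exact: h.
by apply/funext => x; rewrite mxE.
Qed.

Lemma mderiveM m n p (F : E -> 'M[R]_(m, n)) (G : E -> 'M[R]_(n, p)) u v DF DG :
  mderive F u v DF -> mderive G u v DG ->
  mderive (fun x => F x *m G x) u v (DF *m G u + F u *m DG).
Proof.
move=> HF HG a b; rewrite !mxE -big_split /=.
rewrite (_ : (fun x => _) = fun x => \sum_j F x a j * G x j b); last first.
  by apply/funext => x; rewrite mxE.
apply: is_derive_sumf => j; have h := is_deriveM (HF a j) (HG j b).
by apply: is_derive_eq h _; rewrite [LHS]addrC; congr (_ + _); exact: mulrC.
Qed.

Lemma mderiveMl m n p (C : 'M[R]_(m, n)) (G : E -> 'M[R]_(n, p)) u v DG :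
  mderive G u v DG -> mderive (fun x => C *m G x) u v (C *m DG).
Proof. by move/(mderiveM (mderive_cst C u v)); rewrite mul0mx add0r. Qed.

Lemma mderiveMr m n p (F : E -> 'M[R]_(m, n)) (C : 'M[R]_(n, p)) u v DF :
  mderive F u v DF -> mderive (fun x => F x *m C) u v (DF *m C).
Proof. by move=> /mderiveM/(_ (mderive_cst C u v)); rewrite mulmx0 addr0. Qed.

Lemma mderive_tr m n (F : E -> 'M[R]_(m, n)) u v DF :
  mderive F u v DF -> mderive (fun x => (F x)^T) u v DF^T.
Proof.
move=> HF a b; rewrite mxE (_ : (fun x => _) = fun x => F x b a) //.
by apply/funext => x; rewrite mxE.
Qed.

Definition mcontinuous m n (F : E -> 'M[R]_(m, n)) u :=
  forall a b, {for u, continuous (fun x => F x a b)}.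

Lemma mcontinuousM m n p (F : E -> 'M[R]_(m, n)) (G : E -> 'M[R]_(n, p)) u :
  mcontinuous F u -> mcontinuous G u -> mcontinuous (fun x => F x *m G x) u.
Proof.
move=> HF HG a b.
rewrite (_ : (fun x => _) = fun x => \sum_j F x a j * G x j b); last first.
  by apply/funext => x; rewrite mxE.
by apply: continuous_sum => j; exact: (cvgM (HF a j) (HG j b)).
Qed.

Lemma mcontinuousD m n (F G : E -> 'M[R]_(m, n)) u :
  mcontinuous F u -> mcontinuous G u -> mcontinuous (fun x => F x + G x) u.
Proof.
move=> HF HG a b; rewrite (_ : (fun x => _) = fun x => F x a b + G x a b).
  exact: (cvgD (HF a b) (HG a b)).
by apply/funext => x; rewrite mxE.
Qed.

Lemma uniform_approx_continuous (V : set E) (f : E -> R) u : open V -> V u ->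
  (forall e : R, 0 < e -> exists g : E -> R,
     {for u, continuous g} /\ forall w, V w -> `|g w - f w| <= e) ->
  {for u, continuous f}.
Proof.
move=> oV Vu H; apply/continuous_ball => e e0.
have e30 : 0 < e / 3 by rewrite divr_gt0.
have [g [gc gf]] := H _ e30.
have [r r0 Hr] := @near_all_ball _ _ V u unit (fun=> g) _ oV Vu (fun=> gc) e30.
exists r => // w /Hr[Vw /(_ tt)]; have := gf w Vw; have := gf u Vu.
rewrite !ler_norml ltr_norml => /andP[? ?] /andP[? ?] /andP[? ?].
by apply/andP; split; lra.
Qed.

(** The mean value theorem bounds the remainder of the approximant by its derivative near [u].
    Continuity of the limit derivative [g] then accounts for [e], and the approximation errors can
    be made as small as desired. *)
Lemma uniform_approx_derive (V : set E) (f g : E -> R) (i : 'I_N) u :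
  open V -> V u -> {for u, continuous g} ->
  (forall e : R, 0 < e -> exists h dh : E -> R, forall w, V w ->
     [/\ is_derive w (e_ i) h (dh w), `|h w - f w| <= e & `|dh w - g w| <= e]) ->
  is_derive u (e_ i) f (g u).
Proof.
move=> oV Vu gc H; apply: is_derive_eps => e e0.
have [r r0 Hr] := @near_all_ball _ _ V u unit (fun=> g) _ oV Vu (fun=> gc) e0.
have ei0 : 0 < 1 + `|e_ i| by rewrite ltr_pwDl.
exists (r / (1 + `|e_ i|)) => [|s sr]; first by rewrite divr_gt0.
have sB t : between 0 s t -> ball u r (u + t *: e_ i).
  move=> /between_dist; rewrite !subr0 => ts.
  rewrite -ball_normE /ball_ /= opprD addrA subrr sub0r normrN normrZ.
  move: sr; rewrite ltr_pdivlMr //; apply: le_lt_trans.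
  by rewrite ler_pM // lerDr.
(* The approximant is chosen after the increment [s]: two errors in the values and [|s|] times one
   in the derivative amount to [d * (2 + |s|) = c], an arbitrary slack. *)
apply/ler_addgt0Pl => c c0.
have d0 : 0 < c / (2 + `|s|) by rewrite divr_gt0 // ltr_pwDl.
set d := c / _ in d0; have [h [dh Hh]] := H d d0.
have [t tb|t tb Et] := @mean_value R (fun t => h (u + t *: e_ i))
  (fun t => dh (u + t *: e_ i)) 0 s.
  by apply: is_derive_line; have [] := Hh _ (Hr _ (sB _ tb)).1.
have s0b : between 0 s s by rewrite /between ge_min le_max !lexx ?orbT.
have [Vs _] := Hr _ (sB _ s0b); have [Vt gt] := Hr _ (sB _ tb).
have [_ h1 _] := Hh _ Vs; have [_ h2 _] := Hh _ Vu; have [_ _ h3] := Hh _ Vt.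
rewrite scale0r addr0 subr0 in Et; rewrite [s *: _ + u]addrC.
have -> : f (u + s *: e_ i) - f u - s * g u
  = - (h (u + s *: e_ i) - f (u + s *: e_ i)) + (h u - f u)
    + s * (dh (u + t *: e_ i) - g (u + t *: e_ i)) + s * (g (u + t *: e_ i) - g u).
  by rewrite mulrBr [s * dh _]mulrC -Et; ring.
have Es : c = d * (2 + `|s|) by rewrite /d divfK // gt_eqF // ltr_pwDl.
apply: le_trans (ler_normD _ _) _; apply: lerD; last first.
  by rewrite normrM mulrC ler_wpM2r // ltW // (gt tt).
apply: le_trans (ler_normD _ _) _; rewrite Es [leRHS]mulrDr; apply: lerD; last first.
  by rewrite normrM mulrC ler_wpM2r.
apply: le_trans (ler_normD _ _) _; rewrite normrN.
by rewrite [d * 2]mulr_natr mulr2n lerD.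
Qed.

Lemma ex_pow2_lt (K e : R) : 0 < e -> exists n, K / 2 ^+ n <= e.
Proof.
move=> e0; exists (Num.bound `|K / e|).
rewrite ler_pdivrMr ?exprn_gt0 // mulrC -ler_pdivrMr //.
apply: le_trans (ler_norm _) _; apply: le_trans (ltW (archi_boundP _)) _ => //.
by rewrite -natrX ler_nat ltnW // ltn_expl.
Qed.

(* Nested intervals [a_n - 2K/2^n, a_n + 2K/2^n]. *)
Lemma geometric_cauchy (a : nat -> R) (K : R) :
  (forall n, `|a n.+1 - a n| <= K / 2 ^+ n) ->
  exists l, forall n, `|a n - l| <= 2 * K / 2 ^+ n.
Proof.
move=> H; pose q n : R := K / 2 ^+ n.
have qS n : q n.+1 = q n / 2 by rewrite /q exprS; field; rewrite expf_neq0.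
pose b n := a n - 2 * q n; pose c n := a n + 2 * q n.
have step n : b n <= b n.+1 /\ c n.+1 <= c n.
  have := H n; rewrite -/(q n) ler_norml /b /c qS => /andP[? ?]; split; lra.
have q0 n : 0 <= q n by apply: le_trans (H n).
have bmono n k : b n <= b (n + k)%N.
  elim: k => [|k IH]; rewrite ?addn0 // addnS; apply: le_trans IH _.
  by have [] := step (n + k)%N.
have cmono n k : c (n + k)%N <= c n.
  elim: k => [|k IH]; rewrite ?addn0 // addnS; apply: le_trans IH.
  by have [] := step (n + k)%N.
have bc n k : b n <= c k.
  apply: le_trans (bmono n k) _; rewrite addnC; apply: le_trans (cmono k n).
  by rewrite /b /c; have := q0 (k + n)%N; lra.
exists (sup (range b)) => n.
have ub : has_ubound (range b) by exists (c 0%N) => _ [k _ <-].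
have h1 : b n <= sup (range b) by apply: ub_le_sup => //; exists n.
have h2 : sup (range b) <= c n.
  by apply: ge_sup; [exists (b 0%N), 0%N | move=> _ [k _ <-]].
move: h1 h2; rewrite /b /c -mulrA -/(q n) ler_norml => ? ?; apply/andP; split; lra.
Qed.

End matrix_valued.

(** * Linear systems with closed commuting coefficients *)

Section picard.
Variables (R : realType) (N m : nat).
Local Notation E := 'rV[R]_N.
Local Notation e_ i := (delta_mx 0 i : E).
Implicit Types (u v w x : E).

Lemma mulmx_entry_le p q (A : 'M[R]_(p, m)) (X : 'M[R]_(m, q)) (C B : R) a b :
  0 <= C -> (forall i j, `|A i j| <= C) -> (forall i j, `|X i j| <= B) ->
  `|(A *m X) a b| <= m%:R * C * B.
Proof.
move=> C0 AC XB; rewrite mxE; apply: le_trans (ler_norm_sum _ _ _) _.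
rewrite -mulrA mulr_natl -[X in C * B *+ X](card_ord m) -sumr_const.
by apply: ler_sum => j _; rewrite normrM ler_pM.
Qed.

Lemma derive_bound (c u : E) (r B : R) (f : E -> R) (g : 'I_N -> E -> R) :
  0 <= B -> f c = 0 -> ball c r u ->
  (forall i w, ball c r w -> is_derive w (e_ i) f (g i w)) ->
  (forall i w, ball c r w -> `|g i w| <= B) ->
  `|f u| <= N%:R * r * B.
Proof.
move=> B0 fc cu fg gB.
have r0 : 0 < r by case: cu.
have bx w : box c u w -> ball c r w by apply: box_ball => //; exact: ballxx.
have [xi xiP Ef] := box_mean_value (fun i w bw => fg i w (bx w bw)).
rewrite -[f u]subr0 -fc Ef; apply: le_trans (ler_norm_sum _ _ _) _.
rewrite -mulrA mulr_natl -[X in r * B *+ X](card_ord N) -sumr_const.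
apply: ler_sum => i _; rewrite normrM ler_pM ?gB //; last exact: bx.
by case: cu => _ /(_ 0 i); rewrite /ball /= distrC => /ltW.
Qed.

(* Picard iteration X_{n+1} = C + (primitive of A_i X_n du^i). Closedness of
   A_i X_n du^i follows from dX_n = A X_{n-1}, since A is closed and the A_i
   commute. *)
Lemma linear_system (U : set E) (u0 : E) (A : 'I_N -> E -> 'M[R]_m)
    (dA : 'I_N -> 'I_N -> E -> 'M[R]_m) : open U -> U u0 ->
  (forall i a b, C1_on U (fun u => A i u a b) (fun j u => dA i j u a b)) ->
  (forall i j u, U u -> dA i j u = dA j i u) ->
  (forall i j u, U u -> A i u *m A j u = A j u *m A i u) ->
  exists2 r : R, 0 < r & ball u0 r `<=` U /\
    forall p (C : 'M[R]_(m, p)), exists2 X : E -> 'M[R]_(m, p), X u0 = C &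
      forall u, ball u0 r u -> mcontinuous X u /\
        forall i, mderive X u (e_ i) (A i u *m X u).
Proof.
move=> oU Uu0 AC1 closed comm.
(* The sum bounds every entry of every [A i] at [u0]; the 1 pays for their variation on the ball of
   radius [r1]. *)
pose C := 1 + \sum_(k : 'I_N * 'I_m * 'I_m) `|A k.1.1 u0 k.1.2 k.2|.
have C0 : 0 < C by rewrite ltr_pwDl // sumr_ge0.
have [r1 r10 H1] := @near_all_ball R N U u0 ('I_N * 'I_m * 'I_m)%type
  (fun k u => A k.1.1 u k.1.2 k.2) 1 oU Uu0
  (fun k => C1_on_continuous oU (AC1 k.1.1 k.1.2 k.2) Uu0) ltr01.
(* With [r <= S^-1] the factor N r m C of one integration step is at most 1/2, whence the geometric
   convergence. *)
pose S := 2 * (1 + N%:R * m%:R * C).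
have S0 : 0 < S by rewrite mulr_gt0 // ltr_pwDl // !mulr_ge0 // ltW.
pose r := Num.min r1 S^-1.
have r0 : 0 < r by rewrite lt_min r10 invr_gt0.
have rr1 : ball u0 r `<=` ball u0 r1 by apply: le_ball; rewrite ge_min lexx.
have VU : ball u0 r `<=` U by move=> u /rr1 /H1 [].
have AC u i : ball u0 r u -> forall a b, `|A i u a b| <= C.
  move=> /rr1 /H1 [_ H] a b; have := H (i, a, b); rewrite /= => /ltW Hab.
  rewrite -[A i u a b](subrK (A i u0 a b)); apply: le_trans (ler_normD _ _) _.
  rewrite lerD // (bigD1 (i, a, b)) //= lerDl sumr_ge0 //.
have contr K : 0 <= K -> N%:R * r * (m%:R * C * K) <= K / 2.
  move=> K0; have -> : N%:R * r * (m%:R * C * K) = (N%:R * m%:R * C) * r * K by ring.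
  rewrite [leRHS]mulrC ler_wpM2r //.
  apply: (@le_trans _ _ (N%:R * m%:R * C * S^-1)).
    by rewrite ler_wpM2l ?ge_min ?lexx ?orbT // !mulr_ge0 // ltW.
  rewrite ler_pdivrMr // /S mulrA mulVf // mul1r lerDr //.
exists r => //; split=> // p X0.
have oV : open (ball u0 r) by exact: ball_open.
have V0 : ball u0 r u0 by exact: ballxx.
set V := ball u0 r in VU AC oV V0 *.
have Ac u i : V u -> mcontinuous (A i) u.
  by move=> Vu a b; exact: C1_on_continuous oU (AC1 i a b) (VU _ Vu).
(* [Z] is the predecessor of the iterate [X]. It has to be remembered, because the derivative of A_i
   X that proves closedness contains A_i A_j Z. *)
pose Q (Z X : E -> 'M[R]_(m, p)) := forall u, V u -> mcontinuous Z u /\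
  forall i, mderive X u (e_ i) (A i u *m Z u).
have Qc Z X : Q Z X -> forall u, V u -> mcontinuous X u.
  move=> QZX u Vu a b.
  apply: (@C1_on_continuous _ _ V _ (fun i u => (A i u *m Z u) a b)) => // i w Vw.
  have [Zc Xd] := QZX w Vw; split; first exact: Xd.
  exact: mcontinuousM (Ac w i Vw) Zc a b.
have /choice[next nextP] (ZX : (E -> 'M[R]_(m, p)) * (E -> 'M[R]_(m, p))) :
    exists Y, Q ZX.1 ZX.2 -> Q ZX.2 Y /\ Y u0 = X0.
  case: ZX => Z X /=; have [QZX|nQ] := pselect (Q Z X); last by exists X.
  have prim (ab : 'I_m * 'I_p) : exists f : E -> R, f u0 = 0 /\
      forall u, V u -> forall k, is_derive u (e_ k) f ((A k u *m X u) ab.1 ab.2).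
    have [|i j u Vu|f f0 fP] := @poincare R N u0 r
      (fun i u => (A i u *m X u) ab.1 ab.2)
      (fun i j u => (dA i j u *m X u + A i u *m (A j u *m Z u)) ab.1 ab.2) r0.
    - move=> i j u Vu; have [Zc Xd] := QZX u Vu; have Uu := VU u Vu; split.
        apply: mderiveM; last exact: Xd.
        by move=> a b; exact: (AC1 i a b j u Uu).1.
      apply: mcontinuousD; apply: mcontinuousM.
      + by move=> a b; exact: (AC1 i a b j u Uu).2.
      + exact: Qc QZX u Vu.
      + exact: Ac.
      + by apply: mcontinuousM => //; exact: Ac.
    - by have Uu := VU u Vu; rewrite /= (closed i j u Uu) !mulmxA (comm i j u Uu).
    by exists f.
  have [f fP] := choice prim.
  exists (fun u => X0 + \matrix_(a, b) f (a, b) u) => _; split.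
    move=> u Vu; split=> [|i]; first exact: Qc QZX u Vu.
    rewrite -[A i u *m X u]add0r; apply: mderiveD; first exact: mderive_cst.
    move=> a b; rewrite (_ : (fun x => _) = f (a, b)); first exact: (fP (a, b)).2.
    by apply/funext => x; rewrite mxE.
  by apply/matrixP => a b; rewrite !mxE (fP (a, b)).1 addr0.
(* A constant has derivative A_i 0, so the zero function is a valid predecessor of the initial
   iterate. *)
pose s n := iter n (fun ZX => (ZX.2, next ZX))
  ((fun=> 0) : E -> 'M[R]_(m, p), (fun=> X0) : E -> 'M[R]_(m, p)).
pose X n := (s n).2.
have sQ n : Q (s n).1 (s n).2 /\ X n u0 = X0.
  elim: n => [|n [IH _]].
    split=> // u Vu; split=> [a b|i]; first exact: cst_continuous.
    by rewrite mulmx0; exact: mderive_cst.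
  by have [] := nextP _ IH.
have XQ n : Q (X n) (X n.+1) by have [] := sQ n.+1.
pose K := \sum_(k : 'I_m * 'I_p) `|X0 k.1 k.2|.
have K0 : 0 <= K by rewrite sumr_ge0.
have Kn0 n : 0 <= K / 2 ^+ n by rewrite divr_ge0 // exprn_ge0.
have Xd n u : V u -> forall a b, `|X n.+1 u a b - X n u a b| <= K / 2 ^+ n.
  elim: n u => [|n IH] u Vu a b.
    rewrite expr0 divr1; apply: le_trans (_ : K / 2 <= K); last by lra.
    apply: le_trans (contr K K0).
    apply: (@derive_bound u0 u r _ (fun u => X 1%N u a b - X 0%N u a b)
      (fun i u => (A i u *m X 0%N u) a b)) => //.
    - by rewrite !mulr_ge0 // ltW.
    - by rewrite !(sQ _).2 subrr.
    - move=> i w Vw; have d := (XQ 0%N w Vw).2 i a b.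
      have d0 := is_derive_cst (X 0%N u0 a b) w (e_ i).
      by apply: is_derive_eq (is_deriveB d d0) _; rewrite subr0.
    move=> i w Vw; apply: mulmx_entry_le; [exact: ltW | exact: AC|] => a' b'.
    by rewrite /X /= /K (bigD1 (a', b')) //= lerDl sumr_ge0.
  rewrite exprS invfM [2^-1 * _]mulrC mulrA.
  apply: le_trans (contr _ (Kn0 n)).
  apply: (@derive_bound u0 u r _ (fun u => X n.+2 u a b - X n.+1 u a b)
      (fun i u => (A i u *m (X n.+1 u - X n u)) a b)) => //.
  - by rewrite !mulr_ge0 // ?(ltW C0) // invr_ge0 exprn_ge0.
  - by rewrite !(sQ _).2 subrr.
  - move=> i w Vw; have d := (XQ n.+1 w Vw).2 i a b.
    have d' := (XQ n w Vw).2 i a b.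
    by apply: is_derive_eq (is_deriveB d d') _; rewrite mulmxBr !mxE.
  move=> i w Vw; apply: mulmx_entry_le; [exact: ltW | exact: AC|] => a' b'.
  by rewrite !mxE IH.
have lim u : exists L : 'M[R]_(m, p), V u ->
    forall n a b, `|X n u a b - L a b| <= 2 * K / 2 ^+ n.
  have [Vu|nV] := pselect (V u); last by exists 0.
  have /choice[l lP] (ab : 'I_m * 'I_p) : exists l,
      forall n, `|X n u ab.1 ab.2 - l| <= 2 * K / 2 ^+ n.
    by apply: geometric_cauchy => n; exact: Xd.
  by exists (\matrix_(a, b) l (a, b)) => _ n a b; rewrite mxE; exact: (lP (a, b)).
have [Y YP] := choice lim.
have Yc u : V u -> mcontinuous Y u.
  move=> Vu a b; refine (@uniform_approx_continuous R N V (fun x => Y x a b) u oV Vu _) => e e0.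
  have [n ne] := ex_pow2_lt (2 * K) e0.
  exists (fun w => X n w a b); split; first exact: Qc (sQ n).1 u Vu a b.
  by move=> w Vw; apply: le_trans (YP w Vw n a b) ne.
exists Y.
  apply/matrixP => a b; apply/eqP; rewrite -subr_eq0 -normr_le0.
  apply/ler_addgt0Pl => e e0; rewrite addr0.
  have [n ne] := ex_pow2_lt (2 * K) e0.
  by rewrite distrC -(sQ n).2; apply: le_trans ne; exact: YP.
move=> u Vu; split=> [|i a b]; first exact: Yc.
apply: (@uniform_approx_derive R N V (fun x => Y x a b) (fun w => (A i w *m Y w) a b)) => //.
  exact: mcontinuousM (Ac u i Vu) (Yc u Vu) a b.
(* The error in the derivative is m C times the error in the values; the factor [M] dominates both
   that one and 1. *)
move=> e e0; pose M := 1 + m%:R * C.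
have M1 : 1 <= M by rewrite lerDl mulr_ge0 // ltW.
have [n ne] := ex_pow2_lt (2 * K * M) e0.
have {}ne : 2 * K / 2 ^+ n * M <= e by rewrite mulrAC.
have q0 : 0 <= 2 * K / 2 ^+ n by rewrite -mulrA mulr_ge0.
exists (fun w => X n.+1 w a b), (fun w => (A i w *m X n w) a b) => w Vw; split.
- exact: (XQ n w Vw).2 i a b.
- apply: le_trans (YP w Vw n.+1 a b) _; apply: le_trans ne.
  apply: (@le_trans _ _ (2 * K / 2 ^+ n)); last by rewrite ler_peMr.
  rewrite -!mulrA !ler_wpM2l // lef_pV2 ?posrE ?exprn_gt0 //.
  by rewrite exprS ler_peMl ?exprn_ge0 // ler1n.
rewrite (_ : _ - _ = (A i w *m (X n w - Y w)) a b); last by rewrite mulmxBr !mxE.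
apply: (@le_trans _ _ (m%:R * C * (2 * K / 2 ^+ n))).
  apply: mulmx_entry_le; [exact: ltW | exact: AC|] => a' b'.
  by rewrite !mxE; exact: YP.
by apply: le_trans ne; rewrite mulrC ler_wpM2l // lerDr.
Qed.

End picard.

(** * Smooth functions *)

Lemma near_open_eq (T : topologicalType) (U : Type) (V : set T) (f g : T -> U)
    (u : T) : open V -> V u -> (forall w, V w -> f w = g w) ->
  \near u, f u = g u.
Proof.
move=> oV Vu fg; have : nbhs u V by exact: open_nbhs_nbhs.
by apply: filterS => w; exact: fg.
Qed.

Lemma eq_open_continuous (T U : topologicalType) (V : set T) (f g : T -> U)
    (u : T) : open V -> V u -> (forall w, V w -> f w = g w) ->
  {for u, continuous f} -> {for u, continuous g}.
Proof.
move=> oV Vu fg fc; suff : g x @[x --> u] --> g u by [].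
rewrite -(fg u Vu); apply: cvg_trans fc; apply: near_eq_cvg.
exact: near_open_eq fg.
Qed.

Section smooth_functions.
Variables (R : realType) (N : nat).
Local Notation E := 'rV[R]_N.
Local Notation e_ i := (delta_mx 0 i : E).
Implicit Types (u v w x : E) (V : set E).

(** Regularity is graded by order, so that the Leibniz rule and the bootstrap for linear systems are
    inductions on [n]. *)
Fixpoint Ck (W : normedModType R) V n (f : E -> W) : Prop :=
  (forall u, V u -> {for u, continuous f}) /\
  if n is n'.+1 then
    forall i, (forall u, V u -> derivable f u (e_ i)) /\ Ck V n' (partial i f)
  else True.

Lemma smooth_on_partial (W : normedModType R) V (f : E -> W) i :
  smooth_on V f -> smooth_on V (partial i f).
Proof. by move=> H s u Vu; have := H (rcons s i) u Vu; rewrite /iter_partial foldr_rcons. Qed.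

(** [iter_partial] applies the last index of the list first, hence the induction from the right
    end. *)
Lemma smooth_onP (W : normedModType R) V (f : E -> W) :
  smooth_on V f <-> forall n, Ck V n f.
Proof.
split=> [+ n|+ s].
  elim: n f => [|n IH] f H /=.
    by split=> // u Vu; have [] := H [::] u Vu.
  split=> [u Vu|i]; first by have [] := H [::] u Vu.
  split=> [u Vu|]; first by have [_ /(_ i)] := H [::] u Vu.
  by apply: IH; exact: smooth_on_partial.
elim/last_ind: s f => [|s i IH] f H u Vu.
  by have [fc fd] := H 1%N; split=> [|i]; [exact: fc | have [+ _] := fd i; exact].
rewrite /iter_partial foldr_rcons; apply: IH Vu => n.
by have [_ /(_ i)[]] := H n.+1.
Qed.

Lemma Ck_continuous (W : normedModType R) V n (f : E -> W) u :
  Ck V n f -> V u -> {for u, continuous f}.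
Proof. by case: n => [|n] [+ _]; exact. Qed.

Lemma CkW (W : normedModType R) V n (f : E -> W) : Ck V n.+1 f -> Ck V n f.
Proof.
elim: n f => [|n IH] f [fc H]; first by split.
by split=> // i; have [fd Hi] := H i; split=> //; exact: IH.
Qed.

Lemma eq_open_partial (W : normedModType R) V (f g : E -> W) i u :
  open V -> V u -> (forall w, V w -> f w = g w) -> partial i f u = partial i g u.
Proof. by move=> oV Vu fg; apply: near_eq_derive; exact: near_open_eq fg. Qed.

Lemma eq_open_Ck (W : normedModType R) V n (f g : E -> W) : open V ->
  (forall w, V w -> f w = g w) -> Ck V n f -> Ck V n g.
Proof.
move=> oV; elim: n f g => [|n IH] f g fg [fc H].
all: have gc u : V u -> {for u, continuous g}.
1,3: by move=> Vu; exact: eq_open_continuous fg (fc u Vu).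
  by split.
split=> // i; have [fd Hi] := H i; split=> [u Vu|].
  apply: near_eq_derivable (fd u Vu); exact: near_open_eq fg.
by apply: IH Hi => w Vw; exact: eq_open_partial fg.
Qed.

Lemma eq_open_smooth (W : normedModType R) V (f g : E -> W) : open V ->
  (forall w, V w -> f w = g w) -> smooth_on V f -> smooth_on V g.
Proof.
by move=> oV fg /smooth_onP H; apply/smooth_onP => n; exact: eq_open_Ck fg (H n).
Qed.

Lemma smooth_on_sub (W : normedModType R) V V' (f : E -> W) :
  V' `<=` V -> smooth_on V f -> smooth_on V' f.
Proof. by move=> VV' H s u /VV'; exact: H. Qed.

Lemma smooth_is_derive V (f : E -> R) i u : smooth_on V f -> V u ->
  is_derive u (e_ i) f (partial i f u).
Proof. by move=> H Vu; have [_ /(_ i) d] := H [::] u Vu; exact: derivableP. Qed.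

Lemma smooth_continuous (W : normedModType R) V (f : E -> W) u :
  smooth_on V f -> V u -> {for u, continuous f}.
Proof. by move=> H Vu; have [] := H [::] u Vu. Qed.

Lemma partialC V (f : E -> R) i j u : open V -> smooth_on V f -> V u ->
  partial i (partial j f) u = partial j (partial i f) u.
Proof.
move=> oV fs Vu; have s1 k := smooth_on_partial k fs.
apply: (@schwarz R N V f (partial j f) (partial i f) _ _ j i) => //.
- by move=> w Vw; exact: smooth_is_derive fs Vw.
- by move=> w Vw; exact: smooth_is_derive fs Vw.
- by move=> w Vw; exact: smooth_is_derive (s1 j) Vw.
- by move=> w Vw; exact: smooth_is_derive (s1 i) Vw.
- exact: smooth_continuous (smooth_on_partial _ (s1 j)) Vu.
exact: smooth_continuous (smooth_on_partial _ (s1 i)) Vu.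
Qed.

(** The derivatives may be given by any formula valid on [V]; continuity of [f] follows from
    theirs. *)
Lemma Ck_intro V n (f : E -> R) (g : 'I_N -> E -> R) : open V ->
  (forall i u, V u -> is_derive u (e_ i) f (g i u)) ->
  (forall i, Ck V n (g i)) -> Ck V n.+1 f.
Proof.
move=> oV fg gC; split=> [u Vu|i].
  apply: (C1_on_continuous oV _ Vu) => i w Vw; split; [exact: fg | exact: Ck_continuous Vw].
split=> [u Vu|]; first by have [] := fg i u Vu.
by apply: eq_open_Ck (gC i) => // w Vw; have [_ <-] := fg i w Vw.
Qed.

Lemma Ck_cst V n (c : R) : open V -> Ck V n (fun=> c : R).
Proof.
move=> oV; elim: n c => [|n IH] c.
  by split=> // u _; exact: cst_continuous.
by apply: (@Ck_intro _ _ _ (fun _ _ => 0)) => // i u _; exact: is_derive_cst.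
Qed.

Lemma CkD V n (f g : E -> R) : open V -> Ck V n f -> Ck V n g ->
  Ck V n (fun x => f x + g x).
Proof.
move=> oV; elim: n f g => [|n IH] f g [fc Hf] [gc Hg].
  by split=> // u Vu; exact: cvgD (fc u Vu) (gc u Vu).
apply: (@Ck_intro _ _ _ (fun i x => partial i f x + partial i g x)) => // i.
  move=> u Vu; have df := derivableP ((Hf i).1 u Vu).
  by have dg := derivableP ((Hg i).1 u Vu); exact: is_deriveD df dg.
by apply: IH; [exact: (Hf i).2 | exact: (Hg i).2].
Qed.

Lemma CkM V n (f g : E -> R) : open V -> Ck V n f -> Ck V n g ->
  Ck V n (fun x => f x * g x).
Proof.
move=> oV; elim: n f g => [|n IH] f g Cf Cg.
  have [fc _] := Cf; have [gc _] := Cg.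
  by split=> // u Vu; exact: cvgM (fc u Vu) (gc u Vu).
have [fc Hf] := Cf; have [gc Hg] := Cg.
apply: (@Ck_intro _ _ _
  (fun i x => f x * partial i g x + g x * partial i f x)) => // i.
  move=> u Vu; have df := derivableP ((Hf i).1 u Vu).
  by have dg := derivableP ((Hg i).1 u Vu); exact: is_deriveM df dg.
by apply: CkD => //; apply: IH; [exact: CkW | exact: (Hg i).2 |
  exact: CkW | exact: (Hf i).2].
Qed.

Lemma Ck_sum V n (I : Type) (r : seq I) (f : I -> E -> R) : open V ->
  (forall i, Ck V n (f i)) -> Ck V n (fun x => \sum_(i <- r) f i x).
Proof.
move=> oV H; elim: r => [|i r IH].
  by apply: eq_open_Ck (Ck_cst n 0 oV) => // w _; rewrite big_nil.
by apply: eq_open_Ck (CkD oV (H i) IH) => // w _; rewrite big_cons.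
Qed.

Lemma mx_continuousP m n (F : E -> 'M[R]_(m, n)) u :
  {for u, continuous F} <-> mcontinuous F u.
Proof.
split=> [Fc a b|H].
  exact: (@continuous_comp E 'M[R]_(m, n) R F (fun M : 'M[R]_(m, n) => M a b) u
    Fc (@coord_continuous R m n a b (F u))).
apply/continuous_ball => e e0.
have [r r0 Hr] := @near_all_ball R N setT u ('I_m * 'I_n)%type
  (fun k x => F x k.1 k.2) e openT I (fun k => H k.1 k.2) e0.
exists r => // w /Hr[_ Hw]; rewrite [leLHS]/Num.Def.normr /= mx_normrE.
apply/bigmax_leP; split=> [|k _]; first exact: ltW.
by rewrite !mxE ltW.
Qed.

Lemma partial_mxE m n (F : E -> 'M[R]_(m, n)) i u a b :
  derivable F u (e_ i) -> partial i F u a b = partial i (fun x => F x a b) u.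
Proof. by move=> dF; rewrite /partial derive_mx // mxE. Qed.

Lemma Ck_mxP m n V k (F : E -> 'M[R]_(m, n)) : open V ->
  Ck V k F <-> forall a b, Ck V k (fun x => F x a b).
Proof.
move=> oV; split.
  elim: k F => [|k IH] F [Fc H] a b.
    by split=> // u Vu; move: a b; apply/mx_continuousP; exact: Fc.
  split=> [u Vu|i]; first by move: a b; apply/mx_continuousP; exact: Fc.
  have [Fd Hi] := H i; split=> [u Vu|].
    by have /derivable_mxP := Fd u Vu; exact.
  by apply: eq_open_Ck (IH _ Hi a b) => // w Vw; rewrite partial_mxE //; exact: Fd.
elim: k F => [|k IH] F H.
  by split=> // u Vu; apply/mx_continuousP => a b; exact: Ck_continuous (H a b) Vu.
split=> [u Vu|i].
  by apply/mx_continuousP => a b; exact: Ck_continuous (H a b) Vu.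
have Fd u : V u -> derivable F u (e_ i).
  by move=> Vu; apply/derivable_mxP => a b; have [_ /(_ i)[+ _]] := H a b; exact.
split=> //; apply: IH => a b; have [_ /(_ i)[_ Hi]] := H a b.
by apply: eq_open_Ck Hi => // w Vw; rewrite partial_mxE //; exact: Fd.
Qed.

Lemma smooth_mxP m n V (F : E -> 'M[R]_(m, n)) : open V ->
  smooth_on V F <-> forall a b, smooth_on V (fun x => F x a b).
Proof.
move=> oV; split=> [/smooth_onP H a b|H].
  by apply/smooth_onP => k; have /(Ck_mxP _ _ oV) := H k; exact.
apply/smooth_onP => k; apply/(Ck_mxP _ _ oV) => a b.
by have /smooth_onP := H a b; exact.
Qed.

Lemma smooth_mderive m n V (F : E -> 'M[R]_(m, n)) i u : open V ->
  smooth_on V F -> V u -> mderive F u (e_ i) (partial i F u).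
Proof.
move=> oV Fs Vu a b; have [_ /(_ i) Fd] := Fs [::] u Vu.
rewrite partial_mxE //; apply: smooth_is_derive Vu.
by move: a b; apply/smooth_mxP.
Qed.

Lemma mderive_partial m n (F : E -> 'M[R]_(m, n)) i u D :
  mderive F u (e_ i) D -> partial i F u = D.
Proof.
move=> H; apply/matrixP => a b; rewrite partial_mxE; first by have [] := H a b.
by apply/derivable_mxP => a' b'; have [] := H a' b'.
Qed.

Lemma smooth_cst V (c : R) : open V -> smooth_on V (fun=> c : R).
Proof. by move=> oV; apply/smooth_onP => n; exact: Ck_cst. Qed.

Lemma smooth_mxcst m n V (C : 'M[R]_(m, n)) : open V -> smooth_on V (fun=> C).
Proof. by move=> oV; apply/smooth_mxP => // a b; exact: smooth_cst. Qed.

Lemma smooth_mxM m n p V (F : E -> 'M[R]_(m, n)) (G : E -> 'M[R]_(n, p)) :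
  open V -> smooth_on V F -> smooth_on V G -> smooth_on V (fun x => F x *m G x).
Proof.
move=> oV /(smooth_mxP _ oV) HF /(smooth_mxP _ oV) HG; apply/smooth_mxP => // a b.
apply: (@eq_open_smooth _ _ (fun x => \sum_j F x a j * G x j b)) => //.
  by move=> w _; rewrite mxE.
apply/smooth_onP => k; apply: Ck_sum => // j; apply: CkM => //.
  by have /smooth_onP := HF a j; exact.
by have /smooth_onP := HG j b; exact.
Qed.

(** Bootstrap: if [X] is C^k then so are its partial derivatives A_i X, hence [X] is C^(k+1). *)
Lemma linear_system_smooth m n V (A : 'I_N -> E -> 'M[R]_m)
    (X : E -> 'M[R]_(m, n)) : open V ->
  (forall i, smooth_on V (A i)) ->
  (forall u, V u -> mcontinuous X u /\
     forall i, mderive X u (e_ i) (A i u *m X u)) -> smooth_on V X.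
Proof.
move=> oV As XA; apply/smooth_onP => k; apply/Ck_mxP => //.
elim: k => [|k IH] a b.
  by split=> // u Vu; exact: (XA u Vu).1.
apply: (@Ck_intro _ _ _ (fun i u => (A i u *m X u) a b)) => // [i u Vu|i].
  exact: (XA u Vu).2.
have [/(smooth_mxP _ oV) As' _] := (As i, I).
apply: (@eq_open_Ck _ _ _ (fun x => \sum_j A i x a j * X x j b)) => //.
  by move=> w _; rewrite mxE.
by apply: Ck_sum => // j; apply: CkM => //; have /smooth_onP := As' a j; exact.
Qed.

End smooth_functions.

(** * Locally constant functions, block matrices and smooth solutions of linear systems *)

Section frames.
Variables (R : realType) (N : nat).
Local Notation E := 'rV[R]_N.
Local Notation e_ i := (delta_mx 0 i : E).
Implicit Types (u v w x : E) (V : set E).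

Lemma zero_derive_ball (f : E -> R) (c u : E) (r : R) : ball c r u ->
  (forall i w, ball c r w -> is_derive w (e_ i) f 0) -> f u = f c.
Proof.
move=> cu H; have r0 : 0 < r by case: cu.
have bx w : box c u w -> ball c r w by apply: box_ball => //; exact: ballxx.
have [xi _ Ef] := box_mean_value (fun i w bw => H i w (bx w bw)).
apply/eqP; rewrite -subr_eq0 Ef big1 // => i _; exact: mulr0.
Qed.

Lemma zero_mderive_ball m n (F : E -> 'M[R]_(m, n)) (c u : E) (r : R) :
  ball c r u -> (forall i w, ball c r w -> mderive F w (e_ i) 0) -> F u = F c.
Proof.
move=> cu H; apply/matrixP => a b.
apply: (@zero_derive_ball (fun x => F x a b) _ _ _ cu) => i w cw.
by have := H i w cw a b; rewrite mxE.
Qed.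

(** [F] is constant on small balls, so any condition on its value defines an open subset of [V];
    applied to a condition and to its negation, this makes the level set of [F u] open and closed in
    [V]. *)
Lemma zero_mderive_connected m n V (F : E -> 'M[R]_(m, n)) u v :
  open V -> connected V -> V u -> V v ->
  (forall i w, V w -> mderive F w (e_ i) 0) -> F v = F u.
Proof.
move=> oV cV Vu Vv H.
have loc w : V w -> exists2 r : R, 0 < r & forall x, ball w r x -> V x /\ F x = F w.
  move=> Vw; have /nbhs_ballP[r r0 Hr] : nbhs w V by exact: open_nbhs_nbhs.
  exists r => // x wx; split; first exact: Hr.
  by apply: zero_mderive_ball wx _ => i z /Hr; exact: H.
have clopen (P : 'M[R]_(m, n) -> Prop) : open [set w | V w /\ P (F w)].
  rewrite openE => w [Vw Pw]; have [r r0 Hr] := loc w Vw.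
  apply/nbhs_ballP; exists r => // x /Hr[Vx Fx]; split=> //; by rewrite Fx.
move: Vv; suff {1}<- : [set w | V w /\ F w = F u] = V by case.
apply: cV; first by exists u.
  exists [set w | V w /\ F w = F u]; first exact: (clopen (fun M => M = F u)).
  by apply/seteqP; split=> w; [case | case=> _ []].
exists (~` [set w | V w /\ F w <> F u]).
  by apply: open_closedC; exact: (clopen (fun M => M <> F u)).
apply/seteqP; split=> w; first by case=> Vw Fw; split=> // -[].
by case=> Vw H'; split=> //; apply: contrapT => ?; exact: H'.
Qed.

Lemma mderive_usub m1 m2 n (F : E -> 'M[R]_(m1 + m2, n)) u v D :
  mderive F u v D -> mderive (fun x => usubmx (F x)) u v (usubmx D).
Proof.
move=> H a b; rewrite mxE (_ : (fun x => _) = fun x => F x (lshift m2 a) b) //.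
by apply/funext => x; rewrite mxE.
Qed.

Lemma mderive_dsub m1 m2 n (F : E -> 'M[R]_(m1 + m2, n)) u v D :
  mderive F u v D -> mderive (fun x => dsubmx (F x)) u v (dsubmx D).
Proof.
move=> H a b; rewrite mxE (_ : (fun x => _) = fun x => F x (rshift m1 a) b) //.
by apply/funext => x; rewrite mxE.
Qed.

Lemma mderive_col m1 m2 n (F1 : E -> 'M[R]_(m1, n)) (F2 : E -> 'M[R]_(m2, n))
    u v D1 D2 : mderive F1 u v D1 -> mderive F2 u v D2 ->
  mderive (fun x => col_mx (F1 x) (F2 x)) u v (col_mx D1 D2).
Proof.
move=> H1 H2 a b; rewrite mxE; case E : (fintype.split a) => [k|k].
  rewrite (_ : (fun x => _) = fun x => F1 x k b) //.
  by apply/funext => x; rewrite mxE E.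
rewrite (_ : (fun x => _) = fun x => F2 x k b) //.
by apply/funext => x; rewrite mxE E.
Qed.

Lemma mderive_row m n1 n2 (F1 : E -> 'M[R]_(m, n1)) (F2 : E -> 'M[R]_(m, n2))
    u v D1 D2 : mderive F1 u v D1 -> mderive F2 u v D2 ->
  mderive (fun x => row_mx (F1 x) (F2 x)) u v (row_mx D1 D2).
Proof.
move=> H1 H2 a b; rewrite mxE; case E : (fintype.split b) => [k|k].
  rewrite (_ : (fun x => _) = fun x => F1 x a k) //.
  by apply/funext => x; rewrite mxE E.
rewrite (_ : (fun x => _) = fun x => F2 x a k) //.
by apply/funext => x; rewrite mxE E.
Qed.

Lemma smooth_col V m1 m2 n (F1 : E -> 'M[R]_(m1, n)) (F2 : E -> 'M[R]_(m2, n)) :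
  open V -> smooth_on V F1 -> smooth_on V F2 ->
  smooth_on V (fun x => col_mx (F1 x) (F2 x)).
Proof.
move=> oV /(smooth_mxP _ oV) H1 /(smooth_mxP _ oV) H2; apply/smooth_mxP => // a b.
case E : (fintype.split a) => [k|k].
  by apply: eq_open_smooth (H1 k b) => // w _; rewrite mxE E.
by apply: eq_open_smooth (H2 k b) => // w _; rewrite mxE E.
Qed.

Lemma smooth_row V m n1 n2 (F1 : E -> 'M[R]_(m, n1)) (F2 : E -> 'M[R]_(m, n2)) :
  open V -> smooth_on V F1 -> smooth_on V F2 ->
  smooth_on V (fun x => row_mx (F1 x) (F2 x)).
Proof.
move=> oV /(smooth_mxP _ oV) H1 /(smooth_mxP _ oV) H2; apply/smooth_mxP => // a b.
case E : (fintype.split b) => [k|k].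
  by apply: eq_open_smooth (H1 a k) => // w _; rewrite mxE E.
by apply: eq_open_smooth (H2 a k) => // w _; rewrite mxE E.
Qed.

Lemma smooth_tr V m n (F : E -> 'M[R]_(m, n)) : open V -> smooth_on V F ->
  smooth_on V (fun x => (F x)^T).
Proof.
move=> oV /(smooth_mxP _ oV) H; apply/smooth_mxP => // a b.
by apply: eq_open_smooth (H b a) => // w _; rewrite mxE.
Qed.

Lemma partial_mxC m n V (F : E -> 'M[R]_(m, n)) i j u : open V ->
  smooth_on V F -> V u -> partial i (partial j F) u = partial j (partial i F) u.
Proof.
move=> oV Fs Vu; have s1 k := smooth_on_partial k Fs.
have Fab a b : smooth_on V (fun x => F x a b) by move: a b; apply/smooth_mxP.
have d k l : derivable (partial k F) u (e_ l) by have [_ H] := s1 k [::] u Vu; exact: H.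
have Ep a b k w : V w -> partial k F w a b = partial k (fun x => F x a b) w.
  by move=> Vw; have [_ H] := Fs [::] w Vw; exact: partial_mxE (H k).
apply/matrixP => a b.
refine (etrans (partial_mxE a b (d j i)) _).
refine (etrans (eq_open_partial i oV Vu (Ep a b j)) _).
refine (etrans _ (esym (partial_mxE a b (d i j)))).
refine (etrans _ (esym (eq_open_partial j oV Vu (Ep a b i)))).
exact: partialC oV (Fab a b) Vu.
Qed.

Lemma linear_system_ex (U : set E) (u0 : E) m (A : 'I_N -> E -> 'M[R]_m) :
  open U -> U u0 -> (forall i, smooth_on U (A i)) ->
  (forall i j u, U u -> partial j (A i) u = partial i (A j) u) ->
  (forall i j u, U u -> A i u *m A j u = A j u *m A i u) ->
  exists2 r : R, 0 < r & ball u0 r `<=` U /\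
    forall p (C : 'M[R]_(m, p)), exists X : E -> 'M[R]_(m, p),
      [/\ X u0 = C, smooth_on (ball u0 r) X &
      forall u i, ball u0 r u -> mderive X u (e_ i) (A i u *m X u)].
Proof.
move=> oU Uu0 As closed comm.
have AC1 i a b : C1_on U (fun u => A i u a b) (fun j u => partial j (A i) u a b).
  move=> j u Uu; split; first exact: (smooth_mderive j oU (As i) Uu a b).
  have := smooth_continuous (smooth_on_partial j (As i)) Uu.
  by move=> /mx_continuousP; exact.
have closed' i j u : U u -> partial j (A i) u = partial i (A j) u by exact: closed.
have [r r0 [rU H]] := linear_system oU Uu0 AC1 closed' comm.
exists r => //; split=> // p C; have [X X0 XP] := H p C.
exists X; split=> //; last by move=> u i /XP[].
apply: linear_system_smooth XP; first exact: ball_open.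
by move=> i; exact: smooth_on_sub (As i).
Qed.

End frames.

(** * Moving frames *)

(* t i j k plays the role of the third derivative of Phi. *)
Section structure_tensor.
Variables (R : realType) (N : nat) (eta : 'M[R]_N) (U : set 'rV[R]_N)
  (t : 'I_N -> 'I_N -> 'I_N -> 'rV[R]_N -> R).
Hypotheses (eta_sym : eta^T = eta) (eta_unit : eta \in unitmx) (oU : open U)
  (t_smooth : forall i j k, smooth_on U (t i j k))
  (tC12 : forall i j k u, U u -> t i j k u = t j i k u)
  (tC23 : forall i j k u, U u -> t i j k u = t i k j u)
  (t_closed : forall i j k l u, U u ->
     partial l (t i j k) u = partial i (t l j k) u)
  (t_assoc : forall u, U u -> forall i j k l : 'I_N,
    \sum_(m < N) \sum_(n < N) invmx eta m n * t i j m u * t n k l u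
    = \sum_(m < N) \sum_(n < N) invmx eta m n * t i k m u * t n j l u).
Local Notation E := 'rV[R]_N.
Local Notation e_ i := (delta_mx 0 i : E).
Implicit Types (u v w : E) (V : set E).

Definition third_mx (i : 'I_N) u : 'M[R]_N := \matrix_(j, k) t i j k u.

Definition structure_mx i u : 'M[R]_N := third_mx i u *m invmx eta.

Definition pair_form : 'M[R]_(N + N) := block_mx eta 0 0 eta.

Definition frame_mx i u : 'M[R]_(N + N) :=
  block_mx 0 (structure_mx i u) (- structure_mx i u) 0.

Lemma third_mxE i j k u : third_mx i u j k = t i j k u.
Proof. exact: mxE. Qed.

Lemma smooth_third_mx i : smooth_on U (third_mx i).
Proof.
apply/(smooth_mxP _ oU) => j k; apply: eq_open_smooth oU _ (t_smooth i j k) => w _.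
by rewrite third_mxE.
Qed.

Lemma third_mx_sym i u : U u -> (third_mx i u)^T = third_mx i u.
Proof. by move=> Uu; apply/matrixP => j k; rewrite !mxE tC23. Qed.

Lemma row_third_mx i j u : U u -> row i (third_mx j u) = row j (third_mx i u).
Proof. by move=> Uu; apply/rowP => k; rewrite !mxE tC12. Qed.

Lemma partial_third_mx i j u : U u ->
  partial j (third_mx i) u = partial i (third_mx j) u.
Proof.
move=> Uu; apply/matrixP => k l.
have d a b : derivable (third_mx a) u (e_ b).
  by have [_ H] := smooth_third_mx a [::] Uu; exact: H.
have Ep a w : U w -> third_mx a w k l = t a k l w by rewrite third_mxE.
rewrite (partial_mxE k l (d i j)) (partial_mxE k l (d j i)).
rewrite (eq_open_partial j oU Uu (Ep i)) (eq_open_partial i oU Uu (Ep j)).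
exact: t_closed.
Qed.

(** These are the associativity equations in matrix form. They exchange the two middle free indices,
    so the row index [a] has to be in front; the symmetry of [t] in its first two indices moves it
    there and back. *)
Lemma third_mxM i j u : U u ->
  third_mx i u *m invmx eta *m third_mx j u
  = third_mx j u *m invmx eta *m third_mx i u.
Proof.
move=> Uu; apply/matrixP => a b.
have Es k l m n : (third_mx k u *m invmx eta *m third_mx l u) m n
    = \sum_(p < N) \sum_(q < N) invmx eta p q * t k m p u
        * t q l n u.
  rewrite mxE exchange_big; apply: eq_bigr => q _; rewrite mxE mulr_suml.
  apply: eq_bigr => p _; rewrite !third_mxE (tC12 q l n Uu).
  by rewrite [invmx eta p q * _]mulrC.
rewrite !Es.
under eq_bigr => p _ do under eq_bigr => q _ do rewrite (tC12 i a p Uu).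
rewrite (t_assoc Uu a i j b); apply: eq_bigr => p _; apply: eq_bigr => q _.
by rewrite (tC12 a j p Uu).
Qed.

Lemma structure_mxM i j u : U u ->
  structure_mx i u *m structure_mx j u = structure_mx j u *m structure_mx i u.
Proof. by move=> Uu; rewrite /structure_mx !mulmxA third_mxM. Qed.

Lemma smooth_structure_mx i : smooth_on U (structure_mx i).
Proof.
by apply: smooth_mxM => //; [exact: smooth_third_mx | exact: smooth_mxcst].
Qed.

Lemma mderive_structure_mx i j u : U u ->
  mderive (structure_mx i) u (e_ j) (partial j (third_mx i) u *m invmx eta).
Proof.
by move=> Uu; apply: mderiveMr; apply: smooth_mderive Uu => //; exact: smooth_third_mx.
Qed.

Lemma frame_mxM i j u : U u ->
  frame_mx i u *m frame_mx j u = frame_mx j u *m frame_mx i u.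
Proof.
move=> Uu; rewrite /frame_mx !mulmx_block.
by rewrite !(mul0mx, mulmx0, add0r, addr0, mulmxN, mulNmx) (structure_mxM i j Uu).
Qed.

Lemma pair_form_sym : pair_form^T = pair_form.
Proof. by rewrite /pair_form tr_block_mx !trmx0 eta_sym. Qed.

Definition pair_form_inv : 'M[R]_(N + N) := block_mx (invmx eta) 0 0 (invmx eta).

Lemma pair_formV : pair_form *m pair_form_inv = 1%:M.
Proof.
rewrite mulmx_block !(mul0mx, mulmx0, add0r, addr0) mulmxV //.
by rewrite -scalar_mx_block.
Qed.

Lemma pair_formVl : pair_form_inv *m pair_form = 1%:M.
Proof. exact: mulmx1C pair_formV. Qed.

Lemma pseudo_euclidean_pair_form : pseudo_euclidean pair_form.
Proof.
split; first exact: pair_form_sym.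
by have [] := mulmx1_unit pair_formV.
Qed.

(** [frame_mx i u *m pair_form] has the off-diagonal blocks [third_mx i u] and its opposite; as
    [third_mx i u] is symmetric, the product is antisymmetric. Multiplying by the inverse form on
    both sides gives the claim. *)
Lemma frame_mx_skew i u : U u ->
  (frame_mx i u)^T *m pair_form_inv = - (pair_form_inv *m frame_mx i u).
Proof.
move=> Uu; have S : (frame_mx i u *m pair_form)^T = - (frame_mx i u *m pair_form).
  rewrite /frame_mx /pair_form mulmx_block !(mul0mx, mulmx0, add0r, addr0).
  rewrite mulNmx /structure_mx mulmxKV // tr_block_mx !trmx0 linearN /=.
  by rewrite third_mx_sym // opp_block_mx !oppr0 opprK.
rewrite trmx_mul pair_form_sym in S.
rewrite -[(frame_mx i u)^T]mul1mx -pair_formVl -(mulmxA pair_form_inv) S.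
by rewrite mulmxN mulNmx mulmxA -[_ *m pair_form *m _]mulmxA pair_formV mulmx1.
Qed.

(* G P^T G0^-1 is the inverse of a frame P with P G P^T = G0. *)
Definition coframe (G : 'M[R]_(N + N)) (P : E -> 'M[R]_(N + N)) u :=
  G *m (P u)^T *m pair_form_inv.

Lemma mderive_coframe G P i u : U u ->
  mderive P u (e_ i) (frame_mx i u *m P u) ->
  mderive (coframe G P) u (e_ i) (- (coframe G P u *m frame_mx i u)).
Proof.
move=> Uu dP; have := mderiveMr pair_form_inv (mderiveMl G (mderive_tr dP)).
rewrite /coframe trmx_mul [G *m (_ *m _)]mulmxA -[_ *m _^T *m pair_form_inv]mulmxA.
by rewrite frame_mx_skew // mulmxN mulmxA.
Qed.

(** The two Leibniz terms cancel. With [P' = P] this preserves the Gram matrix along a solution;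
    with two different frames it makes the matrix between them constant. *)
Lemma mderive_coframe_frame G (P P' : E -> 'M[R]_(N + N)) i u : U u ->
  mderive P u (e_ i) (frame_mx i u *m P u) ->
  mderive P' u (e_ i) (frame_mx i u *m P' u) ->
  mderive (fun x => coframe G P x *m P' x) u (e_ i) 0.
Proof.
move=> Uu dP dP'; have := mderiveM (mderive_coframe G Uu dP) dP'.
by rewrite mulNmx !mulmxA addNr.
Qed.

Lemma coframe_mulr G P u : P u *m G *m (P u)^T = pair_form ->
  P u *m coframe G P u = 1%:M.
Proof. by move=> H; rewrite /coframe !mulmxA H pair_formV. Qed.

Lemma coframe_mull G P u : P u *m G *m (P u)^T = pair_form ->
  coframe G P u *m P u = 1%:M.
Proof. by move/coframe_mulr/mulmx1C. Qed.

(* The position vector is appended to the frame as a last row, so that a single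
   linear system yields both. *)
Definition position_mx i u : 'M[R]_(N + N + 1) :=
  block_mx (frame_mx i u) 0 (row_mx (e_ i) 0) 0.

Lemma smooth_position_mx i : smooth_on U (position_mx i).
Proof.
have s0 m n : smooth_on U (fun=> 0 : 'M[R]_(m, n)) by exact: smooth_mxcst.
have sS := smooth_structure_mx i.
have sN : smooth_on U (fun u => - structure_mx i u).
  apply: (eq_open_smooth oU _ (smooth_mxM oU (smooth_mxcst (- 1%:M) oU) sS)) => w _.
  by rewrite mulNmx mul1mx.
rewrite /position_mx /frame_mx /block_mx.
exact: (smooth_col oU (smooth_row oU (smooth_col oU (smooth_row oU (s0 _ _) sS)
  (smooth_row oU sN (s0 _ _))) (s0 _ _))
  (smooth_row oU (smooth_mxcst _ oU) (s0 _ _))).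
Qed.

Lemma mderive_position_mx i j u : U u ->
  let D := partial j (third_mx i) u *m invmx eta in
  mderive (position_mx i) u (e_ j) (block_mx (block_mx 0 D (- D) 0) 0 0 0).
Proof.
move=> Uu D; have dS := mderive_structure_mx i j Uu.
have d0 m n : mderive (fun=> 0 : 'M[R]_(m, n)) u (e_ j) 0 by exact: mderive_cst.
have dN : mderive (fun x => - structure_mx i x) u (e_ j) (- D).
  exact: mderiveN.
rewrite /position_mx /frame_mx /block_mx.
apply: mderive_col; apply: mderive_row => //; last exact: mderive_cst.
by apply: mderive_col; apply: mderive_row.
Qed.

(** Beyond the commutation of the frame blocks, the extra row requires that row i of M_j equal row j
    of M_i: this is d_i d_j r = d_j d_i r. *)
Lemma position_mxM i j u : U u ->
  position_mx i u *m position_mx j u = position_mx j u *m position_mx i u.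
Proof.
move=> Uu; rewrite /position_mx [LHS]mulmx_block [RHS]mulmx_block.
rewrite !(mul0mx, mulmx0, addr0) (frame_mxM i j Uu) /frame_mx !mul_row_block.
rewrite !(mul0mx, mulmx0, add0r, addr0) /structure_mx !mulmxA -!rowE.
by rewrite row_third_mx.
Qed.

Lemma position_system G Q u0 : U u0 -> Q *m G *m Q^T = pair_form ->
  exists2 r : R, 0 < r & ball u0 r `<=` U /\
  exists (P : E -> 'M[R]_(N + N)) (s : E -> 'rV[R]_(N + N)),
    [/\ P u0 = Q, smooth_on (ball u0 r) P, smooth_on (ball u0 r) s &
    forall u, ball u0 r u ->
      [/\ P u *m G *m (P u)^T = pair_form,
        forall i, mderive P u (e_ i) (frame_mx i u *m P u) &
        forall i, partial i s u = row i (usubmx (P u))]].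
Proof.
move=> Uu0 HQ.
have closed i j u : U u -> partial j (position_mx i) u = partial i (position_mx j) u.
  move=> Uu; rewrite (mderive_partial (mderive_position_mx i j Uu)).
  by rewrite (mderive_partial (mderive_position_mx j i Uu)) partial_third_mx.
have [r r0 [rU H]] := linear_system_ex oU Uu0 smooth_position_mx closed position_mxM.
(* The zero last row puts the point of parameter [u0] at the origin. *)
have [X [X0 Xs XP]] := H _ (col_mx Q 0).
exists r => //; split=> //; have oV : open (ball u0 r) by exact: ball_open.
exists (fun u => usubmx (X u)), (fun u => dsubmx (X u)).
have eM i (M : 'M[R]_(N + N)) : row_mx (e_ i) 0 *m M = row i (usubmx M).
  by rewrite -{1}(vsubmxK M) mul_row_col mul0mx addr0 -rowE.
have XE i u : position_mx i u *m X u
    = col_mx (frame_mx i u *m usubmx (X u)) (row i (usubmx (usubmx (X u)))).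
  by rewrite -{1}(vsubmxK (X u)) mul_block_col !mul0mx !addr0 eM.
have dP u i : ball u0 r u ->
    mderive (fun x => usubmx (X x)) u (e_ i) (frame_mx i u *m usubmx (X u)).
  by move=> Vu; have := mderive_usub (XP u i Vu); rewrite XE // col_mxKu.
split=> //.
- by rewrite X0 col_mxKu.
- apply/smooth_mxP => // a b; have /smooth_mxP Xab := Xs.
  by apply: eq_open_smooth (Xab oV (lshift 1 a) b) => // w _; rewrite mxE.
- apply/smooth_mxP => // a b; have /smooth_mxP Xab := Xs.
  by apply: eq_open_smooth (Xab oV (rshift _ a) b) => // w _; rewrite mxE.
move=> u Vu; split; [| by move=> i; exact: dP |]; last first.
  move=> i; apply: mderive_partial; have := mderive_dsub (XP u i Vu).
  by rewrite XE col_mxKd.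
set P := fun x => usubmx (X x).
have P0 : P u0 = Q by rewrite /P X0 col_mxKu.
(* The product is constant and equals 1 at [u0]. Read as a right inverse instead of a left one, the
   coframe yields P G P^T G0^-1 = 1, which is the Gram condition. *)
have H1 : coframe G P u *m P u = 1%:M.
  rewrite (@zero_mderive_ball _ _ _ _ (fun x => coframe G P x *m P x) u0 u r Vu).
    by rewrite coframe_mull // P0.
  move=> i w Vw; apply: mderive_coframe_frame; first exact: rU.
    exact: dP.
  exact: dP.
have H2 := mulmx1C H1; rewrite /coframe !mulmxA in H2.
by rewrite -[RHS]mul1mx -H2 -[RHS]mulmxA pair_formVl mulmx1.
Qed.

End structure_tensor.

Section adapted_frames.
Variables (R : realType) (N : nat) (eta : 'M[R]_N) (G : 'M[R]_(N + N)).
Hypotheses (eta_sym : eta^T = eta) (eta_unit : eta \in unitmx).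

Lemma mulmx_scal D m p (H : 'M[R]_D) (A : 'M[R]_(m, D)) (B : 'M[R]_(p, D)) i j :
  (A *m H *m B^T) i j = scal H (row i A) (row j B).
Proof.
rewrite /scal -row_mul tr_row !mxE; apply: eq_bigr => k _.
by rewrite [row _ _ _ _]mxE [col _ _ _ _]mxE.
Qed.

Lemma first_formE D (H : 'M[R]_D) (r : 'rV[R]_N -> 'rV[R]_D) u :
  first_form H r u = tangent_frame r u *m H *m (tangent_frame r u)^T.
Proof. by apply/matrixP => i j; rewrite mulmx_scal !rowK mxE. Qed.

Lemma pair_form_frame (T M : 'M[R]_(N, N + N)) :
  col_mx T M *m G *m (col_mx T M)^T = pair_form eta <->
  [/\ T *m G *m T^T = eta, T *m G *m M^T = 0, M *m G *m T^T = 0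
    & M *m G *m M^T = eta].
Proof.
rewrite mul_col_mx tr_col_mx mul_col_row; split; last by case=> -> -> -> ->.
by move/eq_block_mx.
Qed.

(** G P^T G0^-1 is a right inverse of the square matrix P, hence also a left one; as G0 is block
    diagonal, v G P^T G0^-1 P splits into the tangential and the normal part of [v]. *)
Lemma frame_decomposition m (v : 'M[R]_(m, N + N)) (T M : 'M[R]_(N, N + N)) :
  col_mx T M *m G *m (col_mx T M)^T = pair_form eta ->
  v = v *m G *m T^T *m invmx eta *m T + v *m G *m M^T *m invmx eta *m M.
Proof.
move=> H; have H1 : col_mx T M *m (G *m (col_mx T M)^T *m pair_form_inv eta) = 1%:M.
  by rewrite !mulmxA H pair_formV.
have {}H1 := mulmx1C H1.
rewrite -{1}[v]mulmx1 -H1 tr_col_mx mul_mx_row /pair_form_inv mul_row_block.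
by rewrite !mulmx0 addr0 add0r mul_row_col mulmxDr !mulmxA.
Qed.

End adapted_frames.

Section realization.
Variables (R : realType) (N : nat) (eta : 'M[R]_N) (G : 'M[R]_(N + N)).
Variables (t : 'I_N -> 'I_N -> 'I_N -> 'rV[R]_N -> R) (V : set 'rV[R]_N).
Hypotheses (eta_sym : eta^T = eta) (eta_unit : eta \in unitmx) (oV : open V)
  (tC12 : forall i j k u, V u -> t i j k u = t j i k u)
  (tC23 : forall i j k u, V u -> t i j k u = t i k j u).
Local Notation E := 'rV[R]_N.
Local Notation e_ i := (delta_mx 0 i : E).
Implicit Types (u v w : E).

Definition normal_mx (n : 'I_N -> E -> 'rV[R]_(N + N)) u : 'M[R]_(N, N + N) :=
  \matrix_k n k u.

(** * From a solution of the frame equations to a submanifold *)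

Section from_frame.
Variables (T M : E -> 'M[R]_(N, N + N)) (r : E -> 'rV[R]_(N + N)).
Hypotheses (r_smooth : smooth_on V r) (M_smooth : smooth_on V M)
  (gram : forall u, V u ->
    [/\ T u *m G *m (T u)^T = eta, T u *m G *m (M u)^T = 0,
        M u *m G *m (T u)^T = 0 & M u *m G *m (M u)^T = eta])
  (dT : forall u i, V u -> mderive T u (e_ i) (structure_mx eta t i u *m M u))
  (dM : forall u i, V u -> mderive M u (e_ i) (- (structure_mx eta t i u *m T u)))
  (rT : forall u i, V u -> partial i r u = row i (T u)).

Lemma tangent_frameT u : V u -> tangent_frame r u = T u.
Proof. by move=> Vu; apply/row_matrixP => i; rewrite rowK rT. Qed.

Lemma frame_immersion : immersion V r.
Proof.
split=> // u Vu; have [TT _ _ _] := gram Vu; rewrite tangent_frameT //.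
apply/row_freeP; exists (G *m (T u)^T *m invmx eta).
by rewrite !mulmxA TT mulmxV.
Qed.

Lemma frame_first_form u : V u -> first_form G r u = eta.
Proof. by move=> Vu; rewrite first_formE tangent_frameT //; case: (gram Vu). Qed.

Lemma partial_cst (W : normedModType R) (c : W) i u :
  partial i (fun=> c : W) u = 0.
Proof. exact: derive_cst. Qed.

Lemma const_metric_flat (g : E -> 'M[R]_N) (g0 : 'M[R]_N) :
  (forall u, V u -> g u = g0) -> flat_metric V g.
Proof.
move=> gE; have ch k i j u : V u -> christoffel g k i j u = 0.
  move=> Vu; have d a b c : partial a (fun v => g v b c) u = 0.
    rewrite (@eq_open_partial _ _ _ _ _ (fun=> g0 b c) a u oV Vu) ?partial_cst //.
    by move=> w Vw; rewrite gE.
  by rewrite /christoffel big1 ?mulr0 // => l _; rewrite !d addr0 subr0 mulr0.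
move=> l k i j u Vu; rewrite /riemann.
rewrite (eq_open_partial i oV Vu (ch l j k)) (eq_open_partial j oV Vu (ch l i k)).
rewrite !partial_cst subr0 add0r big1 // => m _.
by rewrite !ch // !mul0r subr0.
Qed.

Lemma frame_normal_proj u (v : 'rV[R]_(N + N)) : V u ->
  normal_proj G r u v = v - v *m G *m (T u)^T *m invmx eta *m T u.
Proof. by move=> Vu; rewrite /normal_proj frame_first_form // tangent_frameT. Qed.

(** The derivative of a M is da M + a dM, and dM has tangent rows, so the normal projection leaves
    da M: in the coordinates [a] the normal connection is plain differentiation. *)
Lemma frame_normal_connection (a : E -> 'rV[R]_N) (xi : E -> 'rV[R]_(N + N)) i u :
  smooth_on V a -> (forall w, V w -> xi w = a w *m M w) -> V u ->
  normal_connection G r i xi u = partial i a u *m M u.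
Proof.
move=> a_smooth xiE Vu; have [TT TM MT MM] := gram Vu.
rewrite /normal_connection frame_normal_proj // (eq_open_partial i oV Vu xiE).
rewrite (mderive_partial (mderiveM (smooth_mderive i oV a_smooth Vu) (dM i Vu))).
set x := partial i a u *m _; rewrite !mulmxDl -/x /x.
rewrite -(mulmxA _ (M u) G) -(mulmxA _ (M u *m G)) MT mulmx0 !mul0mx add0r.
rewrite mulmxN !mulNmx !mulmxA -(mulmxA _ (T u) G) -(mulmxA _ (T u *m G)) TT.
by rewrite mulmxK // opprK addrNK.
Qed.

(** A normal field is a M with smooth coordinates [a], and each covariant derivative is again of
    this form; the curvature therefore vanishes by the symmetry of the second derivatives of [a]. *)
Lemma frame_flat_normal_bundle : flat_normal_bundle G V r.
Proof.
move=> xi [xi_smooth xiN] i j u Vu.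
pose a w : 'rV[R]_N := xi w *m G *m (M w)^T *m invmx eta.
have a_smooth : smooth_on V a.
  apply: smooth_mxM oV _ (smooth_mxcst _ oV).
  apply: smooth_mxM oV _ (smooth_tr oV M_smooth).
  exact: smooth_mxM oV xi_smooth (smooth_mxcst _ oV).
have xiE w : V w -> xi w = a w *m M w.
  move=> Vw; have := (pair_form_frame eta G (T w) (M w)).2 (gram Vw).
  move=> /(frame_decomposition eta_unit (xi w)).
  have -> : xi w *m G *m (T w)^T = 0.
    apply/rowP => k; rewrite mulmx_scal mxE row_id -rT //; exact: xiN.
  by rewrite !mul0mx add0r.
have C k w : V w -> normal_connection G r k xi w = partial k a w *m M w.
  exact: frame_normal_connection.
have da k := smooth_on_partial k a_smooth.
refine (etrans (frame_normal_connection i (da j) (C j) Vu) _).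
refine (etrans _ (esym (frame_normal_connection j (da i) (C i) Vu))).
exact: (congr1 (mulmx^~ (M u)) (partial_mxC i j oV a_smooth Vu)).
Qed.

Lemma frame_parallel_normal_frame :
  parallel_normal_frame G eta V r (fun k u => row k (M u)).
Proof.
split.
- move=> k; split.
    apply/smooth_mxP => // a b; have /(smooth_mxP _ oV) Ms := M_smooth.
    by apply: eq_open_smooth oV _ (Ms k b) => w _; rewrite mxE.
  move=> u Vu i; rewrite rT // -mulmx_scal.
  by have [_ _ -> _] := gram Vu; rewrite mxE.
- move=> i k u Vu.
  rewrite (@frame_normal_connection (fun=> delta_mx 0 k)) //.
  + by rewrite partial_cst mul0mx.
  + exact: smooth_mxcst.
  by move=> w _; rewrite rowE.
move=> k l u Vu; rewrite -mulmx_scal; by have [_ _ _ ->] := gram Vu.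
Qed.

Lemma frame_second_form k u : V u ->
  second_form G r (fun u => row k (M u)) u = \matrix_(i, j) t k i j u.
Proof.
move=> Vu; apply/matrixP => i j; rewrite !mxE.
have rTj w : V w -> partial j r w = row j (T w) by exact: rT.
rewrite (eq_open_partial i oV Vu rTj).
have -> : partial i (fun w => row j (T w)) u = row j (structure_mx eta t i u *m M u).
  apply: mderive_partial => a b; rewrite ord1 mxE.
  rewrite (_ : (fun x => _) = fun x => T x j b); first exact: dT.
  by apply/funext => x; rewrite mxE.
rewrite -mulmx_scal -(mulmxA _ (M u) G) -(mulmxA _ (M u *m G)).
have [_ _ _ ->] := gram Vu; rewrite /structure_mx mulmxKV // third_mxE.
by rewrite tC23 // tC12 // tC23.
Qed.

End from_frame.

(** * From a submanifold to a solution of the frame equations *)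

Section to_frame.
Variables (r : E -> 'rV[R]_(N + N)) (n : 'I_N -> E -> 'rV[R]_(N + N)).
Hypotheses (G_sym : G^T = G) (r_smooth : smooth_on V r)
  (first : forall u, V u -> first_form G r u = eta)
  (nF : parallel_normal_frame G eta V r n)
  (second : forall k u, V u ->
     second_form G r (n k) u = \matrix_(i, j) t k i j u).
Local Notation T := (tangent_frame r).
Local Notation M := (normal_mx n).

Definition full_frame u : 'M[R]_(N + N) := col_mx (T u) (M u).

Lemma full_frame_gram u : V u ->
  [/\ T u *m G *m (T u)^T = eta, T u *m G *m (M u)^T = 0,
      M u *m G *m (T u)^T = 0 & M u *m G *m (M u)^T = eta].
Proof.
move=> Vu.
have MT : M u *m G *m (T u)^T = 0.
  apply/matrixP => k i; rewrite mulmx_scal !rowK mxE.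
  by have [_] := frame_normal nF k; exact.
split=> //; first by rewrite -first_formE first.
  apply: (can_inj trmxK); rewrite !trmx_mul trmxK G_sym trmx0.
  by rewrite mulmxA.
apply/matrixP => k l; rewrite mulmx_scal !rowK.
exact: frame_gram nF _ _ _ Vu.
Qed.

Lemma full_frame_pair_form u : V u ->
  full_frame u *m G *m (full_frame u)^T = pair_form eta.
Proof. by move=> Vu; apply/pair_form_frame; exact: full_frame_gram. Qed.

Definition dtangent i u : 'M[R]_(N, N + N) := \matrix_j partial i (partial j r) u.

Definition dnormal i u : 'M[R]_(N, N + N) := \matrix_k partial i (n k) u.

Lemma mderive_tangent i u : V u -> mderive T u (e_ i) (dtangent i u).
Proof.
move=> Vu a b; have sa := smooth_on_partial a r_smooth.
have := smooth_mderive i oV sa Vu 0 b; rewrite mxE.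
rewrite (_ : (fun x => partial a r x 0 b) = fun x => T x a b) //.
by apply/funext => x; rewrite mxE.
Qed.

Lemma mderive_normal i u : V u -> mderive M u (e_ i) (dnormal i u).
Proof.
move=> Vu a b; have [sa _] := frame_normal nF a.
have := smooth_mderive i oV sa Vu 0 b; rewrite mxE.
rewrite (_ : (fun x => n a x 0 b) = fun x => M x a b) //.
by apply/funext => x; rewrite mxE.
Qed.

Lemma mderive_const m p (F : E -> 'M[R]_(m, p)) C u v D :
  V u -> (forall w, V w -> F w = C) -> mderive F u v D -> D = 0.
Proof.
move=> Vu FC dF; apply/matrixP => a b; rewrite mxE.
have [_ <-] := dF a b; have [_ <-] := is_derive_cst (C a b) u v.
apply: near_eq_derive; apply: near_open_eq oV Vu _ => w Vw.
by rewrite FC.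
Qed.

Lemma third_mx_eq i u : V u -> dtangent i u *m G *m (M u)^T = third_mx t i u.
Proof.
move=> Vu; apply/matrixP => j k; rewrite mulmx_scal !rowK third_mxE.
have := second k Vu; move/matrixP/(_ i j); rewrite !mxE => ->.
by rewrite tC12 // tC23.
Qed.

(* The Christoffel symbols <d_i d_j r, d_k r> vanish: they are symmetric in
   (i, j) and skew in (j, k). *)
Lemma dtangent_tangent i u : V u -> dtangent i u *m G *m (T u)^T = 0.
Proof.
move=> Vu; pose K (a b c : 'I_N) := (dtangent a u *m G *m (T u)^T) b c.
have KE a b c : K a b c = scal G (partial a (partial b r) u) (partial c r u).
  by rewrite /K mulmx_scal rowK rowK.
have sym a b c : K a b c = K b a c.
  refine (etrans (KE a b c) (etrans _ (esym (KE b a c)))).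
  exact: (congr1 (fun x => scal G x _) (partial_mxC a b oV r_smooth Vu)).
have skew a b c : K a b c = - K a c b.
  have dTT := mderiveM (mderiveMr G (mderive_tangent a Vu))
    (mderive_tr (mderive_tangent a Vu)).
  have gT w : V w -> T w *m G *m (T w)^T = eta by case/full_frame_gram.
  have /eqP := mderive_const Vu gT dTT; rewrite addr_eq0 => /eqP Ka.
  have E2 : T u *m G *m (dtangent a u)^T = (dtangent a u *m G *m (T u)^T)^T.
    by rewrite !trmx_mul trmxK G_sym mulmxA.
  rewrite E2 in Ka; have := congr1 (fun A : 'M[R]_N => A b c) Ka.
  by rewrite [X in _ = X -> _]mxE [X in - X]mxE.
apply/matrixP => b c; rewrite -/(K i b c) mxE.
have := skew i b c; have := skew b c i; have := skew c i b.
rewrite (sym b i c) (sym c b i) (sym c i b) (sym i c b); lra.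
Qed.

(** In the frame decomposition of the second derivatives of [r], the tangential part vanishes with
    the Christoffel symbols and the normal part is prescribed by the second forms. *)
Lemma gauss i u : V u -> dtangent i u = structure_mx eta t i u *m M u.
Proof.
move=> Vu.
rewrite [LHS](frame_decomposition eta_unit _ (full_frame_pair_form Vu)).
by rewrite dtangent_tangent // !mul0mx add0r third_mx_eq.
Qed.

(** Differentiating the orthogonality of normals and tangents determines the tangential part of the
    derivatives of the normals. *)
Lemma weingarten i u : V u -> dnormal i u = - (structure_mx eta t i u *m T u).
Proof.
move=> Vu.
have dMT := mderiveM (mderiveMr G (mderive_normal i Vu))
  (mderive_tr (mderive_tangent i Vu)).
have gMT w : V w -> M w *m G *m (T w)^T = 0 by case/full_frame_gram.
have /eqP := mderive_const Vu gMT dMT; rewrite addr_eq0 => /eqP E1.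
have E2 : M u *m G *m (dtangent i u)^T = third_mx t i u.
  rewrite -(third_mx_sym tC23) // -third_mx_eq //.
  by rewrite !trmx_mul trmxK G_sym mulmxA.
(* Parallelism says that the derivative of each normal equals its tangential projection. *)
have par : dnormal i u = dnormal i u *m G *m (T u)^T *m invmx eta *m T u.
  apply/row_matrixP => k; rewrite !row_mul rowK.
  have := frame_parallel nF i k Vu.
  rewrite /normal_connection /normal_proj first // => /eqP.
  by rewrite subr_eq0 => /eqP.
by rewrite par E1 E2 !mulNmx.
Qed.

Lemma mderive_full_frame i u : V u ->
  mderive full_frame u (e_ i) (frame_mx eta t i u *m full_frame u).
Proof.
move=> Vu; have := mderive_col (mderive_tangent i Vu) (mderive_normal i Vu).
rewrite gauss // weingarten // /frame_mx /full_frame mul_block_col.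
by rewrite !mul0mx add0r addr0 mulNmx.
Qed.

End to_frame.
End realization.

(** * Embeddings and signatures *)

Section embeddings.
Variables (R : realType) (N D : nat).
Local Notation E := 'rV[R]_N.
Local Notation e_ i := (delta_mx 0 i : E).
Implicit Types (u v w : E).

Lemma rV_norm_le n (x : 'rV[R]_n) (c : R) : 0 <= c ->
  (forall j, `|x 0 j| <= c) -> `|x| <= c.
Proof.
move=> c0 H; rewrite /Num.Def.normr /= mx_normrE; apply/bigmax_leP; split=> //.
by move=> [a b] _ /=; rewrite ord1.
Qed.

Lemma coord_le_norm n (x : 'rV[R]_n) j : `|x 0 j| <= `|x|.
Proof.
rewrite [leRHS]/Num.Def.normr /= mx_normrE.
exact: (le_bigmax _ (fun ij => `|x ij.1 ij.2|) (0, j)).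
Qed.

Lemma mulmx_continuous (L : 'M[R]_(D, N)) : continuous (fun y : 'rV[R]_D => y *m L).
Proof.
move=> y; apply/mx_continuousP; apply: mcontinuousM => a b.
  exact: coord_continuous.
exact: cst_continuous.
Qed.

(** The map rho = r L has identity Jacobian at [u0]. Close to [u0] the partial derivatives of id -
    rho are small, so this difference has Lipschitz constant 1/2, and |v - u| is absorbed. *)
Lemma lipschitz_inverse (r : E -> 'rV[R]_D) (L : 'M[R]_(D, N)) (u0 : E) (c : R) :
  0 < c -> smooth_on (ball u0 c) r -> tangent_frame r u0 *m L = 1%:M ->
  exists c' : R, [/\ 0 < c', c' <= c &
    forall u v, ball u0 c' u -> ball u0 c' v ->
      `|v - u| <= 2 * `|r v *m L - r u *m L|].
Proof.
move=> c0 rs TL; have oV : open (ball u0 c) by exact: ball_open.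
have V0 : ball u0 c u0 by exact: ballxx.
pose rho w := r w *m L.
have rhos : smooth_on (ball u0 c) rho := smooth_mxM oV rs (smooth_mxcst L oV).
have rhoc j : smooth_on (ball u0 c) (fun w => rho w 0 j).
  by move/(smooth_mxP _ oV) : rhos; exact.
pose g (k : 'I_N * 'I_N) w := partial k.1 (fun w => rho w 0 k.2) w.
have gc k : {for u0, continuous (g k)}.
  exact: smooth_continuous (smooth_on_partial k.1 (rhoc k.2)) V0.
have g0 i j : g (i, j) u0 = (i == j)%:R.
  have d := mderiveMr L (smooth_mderive i oV rs V0).
  have -> : g (i, j) u0 = (partial i r u0 *m L) 0 j by have [_ <-] := d 0 j.
  have -> : partial i r u0 = row i (tangent_frame r u0) by rewrite rowK.
  by rewrite -row_mul TL !mxE.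
(* N terms of size [e] add up to at most 1/2; [N.+1] keeps the denominator positive for every N. *)
pose e : R := (2 * N.+1%:R)^-1.
have e0 : 0 < e by rewrite invr_gt0 mulr_gt0 // ltr0n.
have [c' c'0 H] := near_all_ball oV V0 gc e0.
exists (Num.min c c'); split; [by rewrite lt_min c0 | by rewrite ge_min lexx |].
set W := ball u0 _ => u v Wu Wv.
have Wc' w : W w -> ball u0 c' w by apply: le_ball; rewrite ge_min lexx orbT.
have Wc w : W w -> ball u0 c w by apply: le_ball; rewrite ge_min lexx.
suff : `|v - u| <= `|rho v - rho u| + `|v - u| / 2 by rewrite /rho; lra.
apply: rV_norm_le => [|j]; first by rewrite addr_ge0 // divr_ge0.
have bx w : box u v w -> W w by exact: box_ball.
have [xi xiP Er] := box_mean_value (fun i w bw =>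
  smooth_is_derive i (rhoc j) (Wc w (bx w bw))).
have -> : (v - u) 0 j = (rho v - rho u) 0 j
    - \sum_i (v 0 i - u 0 i) * (g (i, j) (xi i) - g (i, j) u0).
  under eq_bigr => i _ do rewrite mulrBr.
  rewrite sumrB [X in _ = X - _]mxE [(- rho u) 0 j]mxE Er /g /= subKr.
  rewrite (bigD1 j) //= -/(g (j, j) u0) g0 eqxx mulr1 big1 ?addr0 ?mxE //.
  by move=> i ij; rewrite -/(g (i, j) u0) g0 (negPf ij) mulr0.
apply: le_trans (ler_normB _ _) _; rewrite lerD ?coord_le_norm //.
apply: le_trans (ler_norm_sum _ _ _) _.
apply: (@le_trans _ _ (\sum_(i < N) `|v - u| * e)).
  apply: ler_sum => i _; rewrite normrM ler_pM //.
    by have := coord_le_norm (v - u) i; rewrite !mxE.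
  by rewrite ltW // (H _ (Wc' _ (bx _ (xiP i)))).2.
rewrite sumr_const card_ord -[_ *+ N]mulr_natr -mulrA ler_wpM2l //.
rewrite /e invfM -[leLHS]mulrA [_^-1 * N%:R]mulrC ger_pMr ?invr_gt0 //.
by rewrite ler_pdivrMr ?ltr0n // mul1r ler_nat.
Qed.

Lemma lipschitz_embedding (r : E -> 'rV[R]_D) (L : 'M[R]_(D, N)) (V : set E) :
  immersion V r ->
  (forall u v, V u -> V v -> `|v - u| <= 2 * `|r v *m L - r u *m L|) ->
  embedding V r.
Proof.
move=> imm H; split=> //.
  move=> u v; rewrite !inE => Vu Vv ruv; have := H u v Vu Vv.
  by rewrite ruv subrr normr0 mulr0 normr_le0 subr_eq0 => /eqP.
move=> A oA AV.
(* If [r v *m L] lies within e / 2 of [r a *m L], then [v] lies within e of [a]. Such balls thus cut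
   out of the image exactly the points coming from [A]. *)
pose O : set 'rV[R]_N := \bigcup_(ae in [set ae : E * R |
  A ae.1 /\ ball ae.1 ae.2 `<=` A]) ball (r ae.1 *m L) (ae.2 / 2).
exists ((fun y : 'rV[R]_D => y *m L) @^-1` O).
  apply: open_comp; first by move=> y _; exact: mulmx_continuous.
  by apply: bigcup_open => ae _; exact: ball_open.
apply/seteqP; split=> y.
  move=> [a Aa <-]; split; first by exists a => //; exact: AV.
  have /nbhs_ballP[e e0 He] : nbhs a A by exact: open_nbhs_nbhs.
  by exists (a, e) => //=; apply: ballxx; rewrite divr_gt0.
move=> [[v Vv <-] [[a e] /= [Aa aeA] av]]; exists v => //; apply: aeA.
have := H _ _ (AV _ Aa) Vv; rewrite -ball_normE /ball_ /= in av *.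
by rewrite distrC [X in _ <= 2 * X -> _]distrC; lra.
Qed.

End embeddings.

(** * The signature of diag(eta, eta) *)

Section signature.
Variable R : realType.

Lemma pair_std_form N p : (p <= N)%N ->
  exists2 S : 'M[R]_(N + N), S \in unitmx &
    S *m pair_form (std_form R N p) *m S^T = std_form R (N + N) (p + p).
Proof.
move=> pN.
(* [f] sorts the signs of two copies of the standard form: the p plus signs of each copy, then the N
   - p minus signs of each copy. *)
pose f i := if (i < p)%N then i else if (i < p + p)%N then (i - p + N)%N
  else if (i < N + p)%N then (i - p)%N else i.
have fN (i : 'I_(N + N)) : (f i < N + N)%N.
  by have iN := ltn_ord i; rewrite /f; do ![case: ifP => ?]; lia.
pose s0 i := Ordinal (fN i).
have s0_inj : injective s0.
  move=> i j /(congr1 val) /= E; apply: val_inj; move: E => /=.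
  have iN := ltn_ord i; have jN := ltn_ord j.
  by rewrite /f; do ![case: ifP => ?]; lia.
pose s := perm s0_inj.
exists (perm_mx s); first exact: unitmx_perm.
rewrite /pair_form /std_form -diag_mx_row tr_perm_mx -row_permE -col_permE.
apply/matrixP => i j; rewrite !mxE (inj_eq perm_inj); congr (_ *+ _).
have sE : nat_of_ord (s i) = f i by rewrite permE.
have iN := ltn_ord i.
case: splitP => k; have kN := ltn_ord k; rewrite sE /f mxE.
  by do ![case: ifP => ?] => // ?; exfalso; lia.
by do ![case: ifP => ?] => // ?; exfalso; lia.
Qed.

Lemma pair_signature N (eta : 'M[R]_N) p q : has_signature eta p q ->
  exists2 S : 'M[R]_(N + N), S \in unitmx &
    S *m pair_form eta *m S^T = std_form R (N + N) (p + p).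
Proof.
move=> [pqN [P Pu PE]]; have pN : (p <= N)%N by rewrite -pqN leq_addr.
have [S Su SE] := pair_std_form pN.
exists (S *m block_mx P 0 0 P).
  by rewrite unitmx_mul Su /= unitmxE det_ublock unitrM -!unitmxE Pu.
rewrite trmx_mul tr_block_mx !trmx0 -SE !mulmxA; congr (_ *m _).
rewrite -!mulmxA; congr (_ *m _); rewrite mulmxA /pair_form !mulmx_block.
by rewrite !(mul0mx, mulmx0, addr0, add0r) PE.
Qed.

Lemma pair_congruence N (eta : 'M[R]_N) (G : 'M[R]_(N + N)) p q :
  has_signature eta p q -> has_signature G (p + p) (q + q) ->
  exists Q : 'M[R]_(N + N), Q *m G *m Q^T = pair_form eta.
Proof.
move=> /pair_signature[S Su SE] [_ [P Pu PE]].
exists (invmx S *m P); rewrite trmx_mul !mulmxA -(mulmxA (invmx S)).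
rewrite -(mulmxA (invmx S) (P *m G)) PE -SE !mulmxA mulVmx // mul1mx.
by rewrite -mulmxA -trmx_mul mulVmx // trmx1 mulmx1.
Qed.

Lemma congruence_signature N (eta : 'M[R]_N) (G P : 'M[R]_(N + N)) p q :
  has_signature eta p q -> P \in unitmx -> P *m G *m P^T = pair_form eta ->
  has_signature G (p + p) (q + q).
Proof.
move=> sig Pu PE; have [S Su SE] := pair_signature sig.
split; first by rewrite addnACA sig.1.
exists (S *m P); first by rewrite unitmx_mul Su.
by rewrite trmx_mul -SE -PE !mulmxA.
Qed.

End signature.

(** * Submanifolds and Frobenius manifolds *)

Section main_results.
Variables (R : realType) (N : nat) (eta : 'M[R]_N) (U : set 'rV[R]_N)
  (Phi : 'rV[R]_N -> R).
Hypotheses (eta_sym : eta^T = eta) (eta_unit : eta \in unitmx) (oU : open U)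
  (Phi_smooth : smooth_on U Phi) (assoc : associativity_equations U eta Phi).
Local Notation E := 'rV[R]_N.
Local Notation e_ i := (delta_mx 0 i : E).
Local Notation t := (partial3 Phi).
Implicit Types (u v w : E) (V : set E).

Lemma partial3_smooth i j k : smooth_on U (t i j k).
Proof.
exact: (smooth_on_partial i (smooth_on_partial j (smooth_on_partial k Phi_smooth))).
Qed.

Lemma partial3_C12 i j k u : U u -> t i j k u = t j i k u.
Proof. exact: (partialC i j oU (smooth_on_partial k Phi_smooth)). Qed.

Lemma partial3_C23 i j k u : U u -> t i j k u = t i k j u.
Proof.
move=> Uu; apply: (eq_open_partial i oU Uu) => w Uw.
exact: (partialC j k oU Phi_smooth Uw).
Qed.

Lemma partial3_closed i j k l u : U u -> partial l (t i j k) u = partial i (t l j k) u.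
Proof.
exact: (partialC l i oU (smooth_on_partial j (smooth_on_partial k Phi_smooth))).
Qed.

(** The congruence [Q] serves as the frame at [u0]. The identity gives existence in one ambient
    space; a congruence obtained from the signature gives existence in any ambient space of that
    signature. *)
Lemma realizable (G Q : 'M[R]_(N + N)) u0 : U u0 ->
  Q *m G *m Q^T = pair_form eta -> locally_realizable G eta Phi U u0.
Proof.
move=> Uu0 QG.
have [c c0 [cU [P [r [P0 Ps rs PP]]]]] := position_system eta_sym eta_unit oU
  partial3_smooth partial3_C12 partial3_C23 partial3_closed assoc Uu0 QG.
have oc : open (ball u0 c) by exact: ball_open.
have Vc0 : ball u0 c u0 by exact: ballxx.
pose T u := usubmx (P u); pose M u := dsubmx (P u).
have gramc u : ball u0 c u ->
    [/\ T u *m G *m (T u)^T = eta, T u *m G *m (M u)^T = 0,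
        M u *m G *m (T u)^T = 0 & M u *m G *m (M u)^T = eta].
  by move=> cu; apply/pair_form_frame; rewrite vsubmxK; have [] := PP u cu.
have rTc u i : ball u0 c u -> partial i r u = row i (T u) by case/PP.
pose L := G *m (T u0)^T *m invmx eta.
have TL : tangent_frame r u0 *m L = 1%:M.
  rewrite (tangent_frameT rTc Vc0) /L !mulmxA.
  by have [-> _ _ _] := gramc u0 Vc0; rewrite mulmxV.
(* The embedding property comes from the Lipschitz bound, which holds only on a smaller ball;
   everything is restricted to it. *)
have [c' [c'0 c'c lip]] := lipschitz_inverse c0 rs TL.
have Vc : ball u0 c' `<=` ball u0 c by exact: le_ball.
have oV : open (ball u0 c') by exact: ball_open.
have VU : ball u0 c' `<=` U by move=> u /Vc /cU.
have sC12 i j k u : ball u0 c' u -> t i j k u = t j i k u.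
  by move=> /VU; exact: partial3_C12.
have sC23 i j k u : ball u0 c' u -> t i j k u = t i k j u.
  by move=> /VU; exact: partial3_C23.
have r_smooth := smooth_on_sub Vc rs.
have M_smooth : smooth_on (ball u0 c') M.
  apply/(smooth_mxP _ oV) => a b; have /(smooth_mxP _ oc) H := Ps.
  apply: eq_open_smooth oV _ (smooth_on_sub Vc (H (rshift N a) b)) => w _.
  by rewrite mxE.
have gram u : ball u0 c' u ->
    [/\ T u *m G *m (T u)^T = eta, T u *m G *m (M u)^T = 0,
        M u *m G *m (T u)^T = 0 & M u *m G *m (M u)^T = eta].
  by move=> /Vc; exact: gramc.
have rT u i : ball u0 c' u -> partial i r u = row i (T u) by move=> /Vc; exact: rTc.
have FP i u : frame_mx eta t i u *m P u
    = col_mx (structure_mx eta t i u *m M u) (- (structure_mx eta t i u *m T u)).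
  rewrite -{1}(vsubmxK (P u)) mul_block_col !mul0mx add0r addr0 mulNmx //.
have dT u i : ball u0 c' u -> mderive T u (e_ i) (structure_mx eta t i u *m M u).
  move=> /Vc /PP[_ dP _]; have := mderive_usub (dP i).
  by rewrite FP col_mxKu.
have dM u i : ball u0 c' u ->
    mderive M u (e_ i) (- (structure_mx eta t i u *m T u)).
  move=> /Vc /PP[_ dP _]; have := mderive_dsub (dP i).
  by rewrite FP col_mxKd.
have imm := @frame_immersion R N eta G _ eta_unit T M r r_smooth gram rT.
have first := @frame_first_form R N eta G _ T M r gram rT.
have flat := const_metric_flat oV first.
have flatN := @frame_flat_normal_bundle R N eta G t _ eta_unit oV T M r M_smooth gram dM rT.
have nF := @frame_parallel_normal_frame R N eta G t _ eta_unit oV T M r M_smooth gram dM rT.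
have second k u (Vu : ball u0 c' u) :=
  @frame_second_form R N eta G t _ eta_unit oV sC12 sC23 T M r gram dT rT k u Vu.
have real : realizes G eta Phi (ball u0 c') r.
  refine (Build_realizes imm first flat flatN _).
  by exists (fun k u => row k (M u)).
have nb : open_nbhs u0 (ball u0 c') by split=> //; exact: ballxx.
exists (ball u0 c'), r; exact: And4 nb VU real (lipschitz_embedding imm lip).
Qed.

Lemma local_existence_of_potential : local_existence U eta Phi.
Proof.
exists (pair_form eta); first exact: pseudo_euclidean_pair_form.
by move=> u0 Uu0; apply: (@realizable _ 1%:M) => //; rewrite mul1mx trmx1 mulmx1.
Qed.

(** In one direction the adapted frame of a realization at [u0] is itself a congruence from [G] to
    diag(eta, eta); in the other, equal signatures provide the initial frame. *)
Lemma ambient_signature_of_potential : ambient_signature U eta Phi.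
Proof.
move=> p q sig G [G_sym G_unit] u0 Uu0; split; last first.
  by move=> /(pair_congruence sig)[Q]; exact: realizable.
move=> [V [r [[oV Vu0] VU [[rs _] first _ _ [n nF second]] _]]].
have gram := full_frame_pair_form G_sym first nF Vu0.
have [Pu _] := mulmx1_unit (coframe_mulr eta_unit gram).
exact: congruence_signature sig Pu gram.
Qed.

(** The constant matrix [C] between the two frames is the linear part of the motion. It preserves
    [G] because both frames have the same Gram matrix, and comparing tangent rows shows that the
    derivative of [r2 - r1 C] is zero. *)
Lemma uniqueness_of_potential : uniqueness_up_to_motions U eta Phi.
Proof.
move=> G [G_sym G_unit] V r1 r2 oV cV VU.
move=> [[s1 _] first1 _ _ [n1 nF1 second1]] [[s2 _] first2 _ _ [n2 nF2 second2]].
(* A connected set may be empty; the identity then serves as the motion. *)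
have [[u0 Vu0]|V0] := pselect (exists u, V u); last first.
  exists id; last by move=> u Vu; case: V0; exists u.
  by split=> //; exists id.
have sC12 i j k u : V u -> t i j k u = t j i k u by move=> /VU; exact: partial3_C12.
have sC23 i j k u : V u -> t i j k u = t i k j u by move=> /VU; exact: partial3_C23.
pose P1 := full_frame r1 n1; pose P2 := full_frame r2 n2.
have d1 i u : V u -> mderive P1 u (e_ i) (frame_mx eta t i u *m P1 u).
  exact: (mderive_full_frame eta_unit oV sC12 sC23 G_sym s1 first1 nF1 second1).
have d2 i u : V u -> mderive P2 u (e_ i) (frame_mx eta t i u *m P2 u).
  exact: (mderive_full_frame eta_unit oV sC12 sC23 G_sym s2 first2 nF2 second2).
have g1 u : V u -> P1 u *m G *m (P1 u)^T = pair_form eta.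
  by move=> Vu; exact: (full_frame_pair_form G_sym first1 nF1 Vu).
have g2 u : V u -> P2 u *m G *m (P2 u)^T = pair_form eta.
  by move=> Vu; exact: (full_frame_pair_form G_sym first2 nF2 Vu).
pose C := coframe eta G P1 u0 *m P2 u0.
have CE u : V u -> P2 u = P1 u *m C.
  move=> Vu; rewrite /C -(@zero_mderive_connected _ _ _ _ V
    (fun x => coframe eta G P1 x *m P2 x) u0 u oV cV Vu0 Vu).
    by rewrite mulmxA (coframe_mulr eta_unit (g1 u Vu)) mul1mx.
  move=> i w Vw.
  exact: (mderive_coframe_frame eta_sym eta_unit sC23 G Vw (d1 i w Vw) (d2 i w Vw)).
have CG : C *m G *m C^T = G.
  have := g2 u0 Vu0; rewrite (CE u0 Vu0) trmx_mul !mulmxA => E2.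
  have H1 := coframe_mull eta_unit (g1 u0 Vu0).
  have H1' : (P1 u0)^T *m (coframe eta G P1 u0)^T = 1%:M.
    by rewrite -trmx_mul H1 trmx1.
  have EG : P1 u0 *m (C *m G *m C^T) *m (P1 u0)^T
      = P1 u0 *m G *m (P1 u0)^T by rewrite (g1 u0 Vu0) -E2 !mulmxA.
  have := congr1 (fun X => coframe eta G P1 u0 *m X *m (coframe eta G P1 u0)^T) EG.
  rewrite /= !mulmxA H1 !mul1mx -!mulmxA H1' !mulmx1.
  by rewrite !mulmxA.
have C_unit : C \in unitmx.
  have : C *m (G *m C^T *m invmx G) = 1%:M by rewrite !mulmxA CG mulmxV.
  by case/mulmx1_unit.
pose b := r2 u0 - r1 u0 *m C.
have rE u : V u -> r2 u = r1 u *m C + b.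
  move=> Vu; apply/eqP; rewrite addrC -subr_eq; apply/eqP.
  apply: (@zero_mderive_connected _ _ _ _ V (fun x => r2 x - r1 x *m C) u0 u oV cV Vu0 Vu).
  move=> i w Vw.
  have := mderiveD (smooth_mderive i oV s2 Vw)
    (mderiveN (mderiveMr C (smooth_mderive i oV s1 Vw))).
  have -> // : partial i r2 w - partial i r1 w *m C = 0.
  have := congr1 (fun A : 'M[R]_(N + N) => row i (usubmx A)) (CE w Vw).
  rewrite /P1 /P2 /full_frame mul_col_mx !col_mxKu row_mul !rowK => ->.
  by rewrite subrr.
exists (fun x => x *m C + b) => //; split.
  exists (fun y => (y - b) *m invmx C) => x.
    by rewrite addrK mulmxK.
  by rewrite mulmxKV // subrK.
move=> x y; have -> : x *m C + b - (y *m C + b) = (x - y) *m C.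
  by rewrite mulmxBl opprD addrACA subrr addr0.
by rewrite /scal -[in RHS]CG trmx_mul !mulmxA.
Qed.

End main_results.

(** * Associativity equations of a Frobenius manifold *)

Section frobenius.
Variables (R : realType) (N : nat) (M : frobenius_manifold R N) (u : 'rV[R]_N).
Hypothesis Uu : fm_dom M u.
Local Notation eta := (fm_eta M).
Local Notation t := (partial3 (fm_pot M)).
Local Notation mul := (fm_mul M u).
Local Notation e_ i := (delta_mx 0 i : 'rV[R]_N).

Lemma frobenius_mul_coord i j n :
  mul (e_ i) (e_ j) 0 n = \sum_s invmx eta n s * t s i j u.
Proof.
rewrite fm_structure // summxE (bigD1 n) //= [X in _ + X]big1 => [|k kn].
  rewrite addr0 summxE; apply: eq_bigr => s _.
  by rewrite mxE [delta_mx _ _ _ _]mxE !eqxx mulr1.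
rewrite summxE big1 // => s _.
by rewrite mxE [delta_mx _ _ _ _]mxE eqxx eq_sym (negPf kn) mulr0.
Qed.

(** Lowering the index of a product with eta turns structure constants into third derivatives. The
    first factor is arbitrary because [frobenius_associativity] takes for it a product of basis
    vectors. *)
Lemma frobenius_mul_lower x k l :
  (mul x (e_ k) *m eta) 0 l = \sum_n x 0 n * t l n k u.
Proof.
have A := fm_algebra Uu; have [eta_sym eta_unit] := fa_nondeg A.
have mul0 z : mul 0 z = 0.
  by have := fa_linear A (-1) 0 0 z; rewrite scaler0 addr0 scaleN1r addNr.
have base n : (mul (e_ n) (e_ k) *m eta) 0 l = t l n k u.
  have -> : mul (e_ n) (e_ k) = (\row_s t s n k u) *m invmx eta.
    apply/rowP => p; rewrite frobenius_mul_coord [RHS]mxE; apply: eq_bigr => s _.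
    by rewrite [X in _ = X * _]mxE mulrC -[in RHS]eta_sym -trmx_inv [_^T _ _]mxE.
  by rewrite mulmxKV // mxE.
have lin s : (mul (\sum_(n <- s) x 0 n *: e_ n) (e_ k) *m eta) 0 l
    = \sum_(n <- s) x 0 n * t l n k u.
  elim: s => [|n s IH]; first by rewrite !big_nil mul0 mul0mx mxE.
  rewrite !big_cons (fa_linear A) mulmxDl -scalemxAl -IH -base.
  by rewrite [LHS]mxE [X in X + _ = _]mxE.
by rewrite -lin -row_sum_delta.
Qed.

(** Each side of the associativity equations is a scalar product <(e_i * e_j) * e_k, e_l>, so
    exchanging j and k amounts to associativity and commutativity of the multiplication. *)
Lemma frobenius_associativity i j k l :
  \sum_(m < N) \sum_(n < N) invmx eta m n * t i j m u * t n k l u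
  = (mul (mul (e_ i) (e_ j)) (e_ k) *m eta) 0 l.
Proof.
have A := fm_algebra Uu; have [eta_sym eta_unit] := fa_nondeg A.
have C12 a b c := @partial3_C12 R N _ _ (@fm_open R N M) (@fm_smooth R N M) a b c u Uu.
have C23 a b c := @partial3_C23 R N _ _ (@fm_open R N M) (@fm_smooth R N M) a b c u Uu.
rewrite frobenius_mul_lower exchange_big; apply: eq_bigr => n _ /=.
rewrite frobenius_mul_coord mulr_suml; apply: eq_bigr => m _.
have -> : invmx eta m n = invmx eta n m by rewrite -[in LHS]eta_sym -trmx_inv mxE.
have -> : t i j m u = t m i j u by rewrite (C23 i j m) (C12 i m j).
by have -> : t n k l u = t l n k u by rewrite (C23 n k l) (C12 n l k).
Qed.

End frobenius.

Lemma frobenius_associativity_equations (R : realType) (N : nat)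
    (M : frobenius_manifold R N) :
  associativity_equations (fm_dom M) (fm_eta M) (fm_pot M).
Proof.
move=> u Uu i j k l; have A := fm_algebra Uu.
refine (etrans (frobenius_associativity Uu i j k l) _).
refine (etrans _ (esym (frobenius_associativity Uu i k j l))).
by rewrite -(fa_assoc A) (fa_comm A (delta_mx 0 j)) (fa_assoc A).
Qed.

Theorem mainTheorem7 (R : realType) (N : nat) (hN : (0 < N)%N) :
  (forall (eta : 'M[R]_N) (U : set 'rV[R]_N) (Phi : 'rV[R]_N -> R),
      eta^T = eta -> eta \in unitmx ->
      open U -> smooth_on U Phi ->
      associativity_equations U eta Phi ->
      [/\ local_existence U eta Phi,
          ambient_signature U eta Phi &
          uniqueness_up_to_motions U eta Phi])
  /\
  (forall M : frobenius_manifold R N,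
      [/\ local_existence (fm_dom M) (fm_eta M) (fm_pot M),
          ambient_signature (fm_dom M) (fm_eta M) (fm_pot M) &
          uniqueness_up_to_motions (fm_dom M) (fm_eta M) (fm_pot M)]).
Proof.
have main (eta : 'M[R]_N) U Phi : eta^T = eta -> eta \in unitmx -> open U ->
    smooth_on U Phi -> associativity_equations U eta Phi ->
    [/\ local_existence U eta Phi, ambient_signature U eta Phi &
        uniqueness_up_to_motions U eta Phi].
  move=> eta_sym eta_unit oU sPhi assoc; split.
  - exact: local_existence_of_potential.
  - exact: ambient_signature_of_potential.
  exact: uniqueness_of_potential.
split=> // M; have [[u Uu]|U0] := pselect (exists u, fm_dom M u).
  have [eta_sym eta_unit] := fa_nondeg (fm_algebra Uu).
  exact: main (@fm_open R N M) (@fm_smooth R N M) (@frobenius_associativity_equations R N M).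
(* The algebra axioms, and with them the nondegeneracy of eta, are stated at points of the domain.
   Over an empty domain the claims are vacuous, and any pseudo-Euclidean form such as [1%:M] will
   do. *)
have empty u : ~ fm_dom M u by move=> Uu; apply: U0; exists u.
split.
- exists 1%:M; first by split; [exact: trmx1 | exact: unitmx1].
  by move=> u /empty.
- by move=> p q _ G _ u /empty.
move=> G _ V r1 r2 _ _ VU _ _; exists id; last by move=> u /VU /empty.
by split=> //; exists id.
Qed.
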